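(* Let $Q$ be a finite quandle, and let $P_Q,P_Q^{\mathrm{dom}}\in\mathbb{Q}[x]$ be the polynomials such that $\int_{\widehat{B_n}} c_{Q,n}\,d\mu=P_Q(n)$ and $\int_{\widehat{B_n}} c^{\mathrm{dom}}_{Q,n}\,d\mu=P^{\mathrm{dom}}_Q(n)$ for all sufficiently large $n$. Then $$\deg P_Q^{\mathrm{dom}}=|\pi_0(Q)|-1,\qquad \deg P_Q=\dim_Q-1,$$ where $\dim_Q=\max_{R\le Q}|\pi_0(R)|$, the maximum being over all sub-quandles $R$ of $Q$.
   Context: A quandle is a set $Q$ with a binary operation $(x,y)\mapsto {}^{x}y$ such that (Q1) ${}^{x}x=x$ for all $x$; (Q2) for every $x$ the map $\varphi_x\colon Q\to Q$, $\varphi_x(y)={}^{x}y$, is a bijection; (Q3) ${}^{x}({}^{y}z)={}^{({}^{x}y)}({}^{x}z)$ for all $x,y,z$. A morphism of quandles is a map $f$ with $f({}^{x}y)={}^{f(x)}f(y)$. A sub-quandle $R\le Q$ is a subset (possibly empty) closed under the operation. $\mathrm{Inn}(Q)$ is the group of automorphisms of $Q$ generated by all $\varphi_x$, $x\in Q$, and $\pi_0(Q)=Q/\mathrm{Inn}(Q)$ is its set of orbits in $Q$ (for a sub-quandle $R$, $\pi_0(R)=R/\mathrm{Inn}(R)$). Oriented (tame) links in $S^3$ are described by diagrams $D$ with a finite set $arcs(D)$ of oriented arcs. For an arc $x$ ending at a crossing as under-strand, $n_x$ is the next arc (the continuation of the under-strand), $c_x$ is the arc passing over $x$ and $n_x$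 at that crossing, and $\varepsilon_x\in\{\pm1\}$ is the orientation of the crossing: rotating the picture so that both strands point downwards, $\varepsilon_x=1$ if the over-strand goes from upper left to lower right, and $\varepsilon_x=-1$ if it goes from upper right to lower left. The fundamental quandle $Q_L$ of the link $L$ is the quandle generated by $arcs(D)$ subject to the relations $\varphi_{c_x}^{\varepsilon_x}(x)=n_x$; up to isomorphism it does not depend on the diagram $D$ of $L$. The set of $Q$-colorings of $L$ is $\mathrm{Col}_Q(L)=\mathrm{Hom}(Q_L,Q)$ (quandle morphisms); equivalently, maps $f\colon arcs(D)\to Q$ with $\varphi_{f(c_x)}^{\varepsilon_x}(f(x))=f(n_x)$ at every crossing. The set of dominant $Q$-colorings is $\mathrm{Col}_Q^{\mathrm{dom}}(L)=\{f\in\mathrm{Hom}(Q_L,Q): f \text{ surjective}\}$. $B_n$ is the Artin braid group on $n$ strands, with generators $\sigma_1,\dots,\sigma_{n-1}$ and relations $\sigma_i\sigma_{i+1}\sigma_i=\sigma_{i+1}\sigma_i\sigma_{i+1}$ and $[\sigma_i,\sigma_j]=1$ for $|i-j|\ge2$. Braids are oriented downwards; in $\sigma_i$ the strand starting on top at position $i$ passes over the strand starting at position $i+1$. The closure $\overline\sigma$ is the oriented link obtained by joining the bottom endpoints of $\sigma$ to the corresponding top endpoints without introducing crossings. $\widehat{B_n}$ is the profinite completion of $B_n$, with Haar measure $\mu$ of total mass $1$. For finite $Q$, the functions $B_n\to\mathbb{N}$, $\sigma\mapsto|\mathrm{Col}_Q(\overline\sigma)|$ and $\sigma\mapsto|\mathrm{Col}^{\mathrm{dom}}_Q(\overline\sigma)|$,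 factor through finite quotients of $B_n$, so they extend uniquely to continuous (locally constant) functions $c_{Q,n}$ and $c_{Q,n}^{\mathrm{dom}}$ on $\widehat{B_n}$. The polynomials $P_Q$ and $P_Q^{\mathrm{dom}}$ in the claim exist and are unique. The degree of the zero polynomial is taken to be $-1$ (relevant only for $Q=\emptyset$). *)

(* Defs.v *)
From HB Require Import structures.
From mathcomp Require Import all_boot all_order all_fingroup all_algebra.
From mathcomp Require Import finmap all_classical all_reals all_analysis.

Set Implicit Arguments.
Unset Strict Implicit.
Unset Printing Implicit Defensive.

Import GroupScope.

(* fingroup rebinds [repr]. *)
Notation quot_repr := generic_quotient.repr (only parsing).

(* [qop x y] is the element written x acting on y, i.e. phi_x(y). *)
HB.mixin Record isQuandle (T : Type) := {
  qop : T -> T -> T;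
  qop_idem : forall x, qop x x = x;
  qop_bij : forall x, bijective (qop x);
  qop_dist : forall x y z, qop x (qop y z) = qop (qop x y) (qop x z)
}.

#[short(type="quandleType")]
HB.structure Definition Quandle := {T of isQuandle T}.

#[short(type="finQuandleType")]
HB.structure Definition FinQuandle := {T of Finite T & isQuandle T}.

Notation "x ▷ y" := (qop x y) (at level 40, left associativity).

Definition quandle_morphism (X Y : quandleType) (f : X -> Y) : Prop :=
  forall x y, f (x ▷ y) = f x ▷ f y.

Section Components.
Variable Q : finQuandleType.

Definition inner (x : Q) : {perm Q} := perm (bij_inj (qop_bij x)).

Definition Inn : {group {perm Q}} := <<[set inner x | x : Q]>>%G.

Definition pi0 : {set {set Q}} := orbit 'P Inn @: [set: Q].

(* The empty subset is a sub-quandle. *)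
Record subquandle := Subquandle {
  sq_set : {set Q};
  sq_closed : [forall x in sq_set, forall y in sq_set, x ▷ y \in sq_set]
}.

HB.instance Definition _ := [isSub for sq_set].
HB.instance Definition _ := [Finite of subquandle by <:].

Definition sq_sort (R : subquandle) : Type := {x : Q | x \in sq_set R}.
Coercion sq_sort : subquandle >-> Sortclass.

Section SubquandleStructure.
Variable R : subquandle.

Lemma sq_opP (x y : R) : val x ▷ val y \in sq_set R.
Proof.
have /forallP/(_ (val x))/implyP/(_ (valP x)) := sq_closed R.
by move=> /forallP/(_ (val y))/implyP/(_ (valP y)).
Qed.

Definition sq_op (x y : R) : R := exist _ (val x ▷ val y) (sq_opP x y).

Lemma sq_op_idem x : sq_op x x = x.
Proof. by apply: val_inj; exact: qop_idem. Qed.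

Lemma sq_op_bij x : bijective (sq_op x).
Proof.
apply: injF_bij => y z /(congr1 val) /= /(bij_inj (qop_bij _)).
exact: val_inj.
Qed.

Lemma sq_op_dist x y z : sq_op x (sq_op y z) = sq_op (sq_op x y) (sq_op x z).
Proof. by apply: val_inj; exact: qop_dist. Qed.

HB.instance Definition _ := Finite.on (sq_sort R).
HB.instance Definition _ :=
  isQuandle.Build (sq_sort R) sq_op_idem sq_op_bij sq_op_dist.
End SubquandleStructure.

End Components.

(* The maximum is over a nonempty finite type, so the default value 0 of
   [\max] plays no role. *)
Definition quandle_dim (Q : finQuandleType) : nat :=
  \max_(R : subquandle Q) #|pi0 R|.

Inductive qterm (A : Type) : Type :=
| QGen of A
| QOp of qterm A & qterm A
| QInv of qterm A & qterm A. (* [QInv s t] stands for phi_s^-1(t) *)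

HB.instance Definition _ (A : Type) := gen_eqMixin (qterm A).
HB.instance Definition _ (A : Type) := gen_choiceMixin (qterm A).

Inductive qcong (A : Type) (rel : qterm A -> qterm A -> Prop) :
  qterm A -> qterm A -> Prop :=
| QC_rel s t : rel s t -> qcong rel s t
| QC_refl s : qcong rel s s
| QC_sym s t : qcong rel s t -> qcong rel t s
| QC_trans s t u : qcong rel s t -> qcong rel t u -> qcong rel s u
| QC_op s s' t t' : qcong rel s s' -> qcong rel t t' ->
    qcong rel (QOp s t) (QOp s' t')
| QC_inv s s' t t' : qcong rel s s' -> qcong rel t t' ->
    qcong rel (QInv s t) (QInv s' t')
| QC_idem s : qcong rel (QOp s s) s
| QC_opK s t : qcong rel (QInv s (QOp s t)) t
| QC_invK s t : qcong rel (QOp s (QInv s t)) t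
| QC_dist s t u :
    qcong rel (QOp s (QOp t u)) (QOp (QOp s t) (QOp s u)).

Section PresentedQuandle.
Local Open Scope quotient_scope.
Variables (A : Type) (rel : qterm A -> qterm A -> Prop).

Definition qcongb (s t : qterm A) : bool := `[< qcong rel s t >].

Lemma qcongb_refl : reflexive qcongb.
Proof. by move=> s; apply/asboolP; exact: QC_refl. Qed.

Lemma qcongb_sym : symmetric qcongb.
Proof. by move=> s t; apply/asboolP/asboolP; exact: QC_sym. Qed.

Lemma qcongb_trans : transitive qcongb.
Proof.
by move=> t s u /asboolP st /asboolP tu; apply/asboolP; exact: QC_trans tu.
Qed.

Canonical qcong_equiv := EquivRel qcongb qcongb_refl qcongb_sym qcongb_trans.

Definition presented_quandle : Type := {eq_quot qcongb}.

HB.instance Definition _ := Choice.on presented_quandle.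
HB.instance Definition _ := EqQuotient.on presented_quandle.

Definition qclass (t : qterm A) : presented_quandle := \pi t.

Definition pq_op (x y : presented_quandle) : presented_quandle :=
  qclass (QOp (quot_repr x) (quot_repr y)).

Definition pq_inv (x y : presented_quandle) : presented_quandle :=
  qclass (QInv (quot_repr x) (quot_repr y)).

Lemma qclassP s t : qclass s = qclass t <-> qcong rel s t.
Proof.
by split=> [/eqmodP/asboolP //|st]; apply/eqmodP/asboolP.
Qed.

Lemma qclass_repr x : qclass (quot_repr x) = x.
Proof. exact: reprK. Qed.

Lemma repr_qclass t : qcong rel (quot_repr (qclass t)) t.
Proof. by apply/qclassP; rewrite qclass_repr. Qed.

Lemma qclass_op s t : pq_op (qclass s) (qclass t) = qclass (QOp s t).
Proof. by apply/qclassP; apply: QC_op; exact: repr_qclass. Qed.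

Lemma qclass_inv s t : pq_inv (qclass s) (qclass t) = qclass (QInv s t).
Proof. by apply/qclassP; apply: QC_inv; exact: repr_qclass. Qed.

Lemma pq_op_idem x : pq_op x x = x.
Proof.
by rewrite -[x]qclass_repr qclass_op; apply/qclassP; exact: QC_idem.
Qed.

Lemma pq_op_bij x : bijective (pq_op x).
Proof.
exists (pq_inv x) => y; rewrite -[x]qclass_repr -[y]qclass_repr.
- by rewrite qclass_op qclass_inv; apply/qclassP; exact: QC_opK.
- by rewrite qclass_inv qclass_op; apply/qclassP; exact: QC_invK.
Qed.

Lemma pq_op_dist x y z :
  pq_op x (pq_op y z) = pq_op (pq_op x y) (pq_op x z).
Proof.
rewrite -[x]qclass_repr -[y]qclass_repr -[z]qclass_repr !qclass_op.
by apply/qclassP; exact: QC_dist.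
Qed.

HB.instance Definition _ :=
  isQuandle.Build presented_quandle pq_op_idem pq_op_bij pq_op_dist.

End PresentedQuandle.

(* An oriented link diagram, reduced to the data entering the presentation of
   the fundamental quandle.  At the crossing [d] the arc x = [under_in d] ends
   as under-strand, n_x = [under_out d] and c_x = [over d]; [positive d] means
   that the orientation of the crossing is +1. *)
Record diagram := Diagram {
  arcs : finType;
  crossings : finType;
  under_in : crossings -> arcs;
  under_out : crossings -> arcs;
  over : crossings -> arcs;
  positive : crossings -> bool
}.

Definition crossing_rel (D : diagram) (s t : qterm (arcs D)) : Prop :=
  exists d : crossings D,
    s = (if positive d then @QOp _ else @QInv _)
          (QGen (over d)) (QGen (under_in d))
    /\ t = QGen (under_out d).

Definition fundamental_quandle (D : diagram) : quandleType :=
  presented_quandle (@crossing_rel D).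

Section Colorings.
Local Open Scope classical_set_scope.
Variables (Q : finQuandleType) (D : diagram).

Definition Col : set (fundamental_quandle D -> Q) :=
  [set f | quandle_morphism f].

Definition Col_dom : set (fundamental_quandle D -> Q) :=
  [set f | quandle_morphism f /\ range f = [set: Q]].

(* Both sets are finite, so that [fset_set] does not take its default value. *)
Definition num_col : nat := #|` fset_set Col|.

Definition num_col_dom : nat := #|` fset_set Col_dom|.

End Colorings.

(* The letter [(i, true)] is the generator sigma_(i+1), and [(i, false)] its
   inverse; in both cases the strands in positions i and i+1 (counted from 0)
   are involved. *)
Definition braid_word (n : nat) : Type := seq ('I_n.-1 * bool).

HB.instance Definition _ n := Choice.on (braid_word n).

Inductive braid_eq (n : nat) : braid_word n -> braid_word n -> Prop :=
| BE_refl u : braid_eq u u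
| BE_sym u v : braid_eq u v -> braid_eq v u
| BE_trans u v w : braid_eq u v -> braid_eq v w -> braid_eq u w
| BE_cat u u' v v' : braid_eq u u' -> braid_eq v v' ->
    braid_eq (u ++ v) (u' ++ v')
| BE_cancel i b : braid_eq [:: (i, b); (i, ~~ b)] [::]
| BE_braid (i j : 'I_n.-1) : j = i.+1 :> nat ->
    braid_eq [:: (i, true); (j, true); (i, true)]
             [:: (j, true); (i, true); (j, true)]
| BE_comm (i j : 'I_n.-1) : i.+1 < j ->
    braid_eq [:: (i, true); (j, true)] [:: (j, true); (i, true)].

Section BraidGroup.
Local Open Scope quotient_scope.
Variable n : nat.
Implicit Types u v w : braid_word n.

Definition braid_eqb u v : bool := `[< braid_eq u v >].

Lemma braid_eqb_refl : reflexive braid_eqb.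
Proof. by move=> s; apply/asboolP; exact: BE_refl. Qed.

Lemma braid_eqb_sym : symmetric braid_eqb.
Proof. by move=> s t; apply/asboolP/asboolP; exact: BE_sym. Qed.

Lemma braid_eqb_trans : transitive braid_eqb.
Proof.
by move=> t s u /asboolP st /asboolP tu; apply/asboolP; exact: BE_trans tu.
Qed.

Canonical braid_equiv :=
  EquivRel braid_eqb braid_eqb_refl braid_eqb_sym braid_eqb_trans.

Definition braid : Type := {eq_quot braid_eqb}.

HB.instance Definition _ := Choice.on braid.
HB.instance Definition _ := EqQuotient.on braid.

Definition braid_class u : braid := \pi u.

Definition inv_word u : braid_word n := rev [seq (l.1, ~~ l.2) | l <- u].

Definition braid_one : braid := braid_class [::].

(* Words are read from top to bottom. *)
Definition braid_mul (x y : braid) : braid := braid_class (quot_repr x ++ quot_repr y).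

Definition braid_inv (x : braid) : braid := braid_class (inv_word (quot_repr x)).

Lemma braid_classP u v : braid_class u = braid_class v <-> braid_eq u v.
Proof. by split=> [/eqmodP/asboolP //|uv]; apply/eqmodP/asboolP. Qed.

Lemma braid_class_repr x : braid_class (quot_repr x) = x.
Proof. exact: reprK. Qed.

Lemma repr_braid_class u : braid_eq (quot_repr (braid_class u)) u.
Proof. by apply/braid_classP; rewrite braid_class_repr. Qed.

Lemma braid_class_cat u v :
  braid_mul (braid_class u) (braid_class v) = braid_class (u ++ v).
Proof. by apply/braid_classP; apply: BE_cat; exact: repr_braid_class. Qed.

Lemma inv_wordK : involutive inv_word.
Proof.
move=> u; rewrite /inv_word map_rev revK -map_comp -[RHS]map_id.
by apply: eq_map => -[i b] /=; rewrite negbK.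
Qed.

Lemma cat_inv_word u : braid_eq (u ++ inv_word u) [::].
Proof.
elim: u => [|[i b] u IHu]; first exact: BE_refl.
rewrite /inv_word /= rev_cons -cats1 catA -[_ :: _]cat1s.
apply: BE_trans (BE_cancel i b); rewrite -[[:: _; _]]cat1s -!catA.
apply: (@BE_cat _ [:: (i, b)]); first exact: BE_refl.
by rewrite catA -[[:: (_, ~~ _)]]cat0s; apply: BE_cat => //; exact: BE_refl.
Qed.

Lemma braid_mulA : associative braid_mul.
Proof.
move=> x y z; rewrite -[x]braid_class_repr -[y]braid_class_repr.
by rewrite -[z]braid_class_repr !braid_class_cat catA.
Qed.

Lemma braid_mul1g : left_id braid_one braid_mul.
Proof. by move=> x; rewrite -[x]braid_class_repr braid_class_cat. Qed.

Lemma braid_mulg1 : right_id braid_one braid_mul.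
Proof. by move=> x; rewrite -[x]braid_class_repr braid_class_cat cats0. Qed.

Lemma braid_mulgV : right_inverse braid_one braid_inv braid_mul.
Proof.
move=> x; rewrite -{1}[x]braid_class_repr braid_class_cat.
by apply/braid_classP; exact: cat_inv_word.
Qed.

Lemma braid_mulVg : left_inverse braid_one braid_inv braid_mul.
Proof.
move=> x; rewrite -{2}[x]braid_class_repr braid_class_cat.
rewrite -{2}[quot_repr x]inv_wordK; apply/braid_classP; exact: cat_inv_word.
Qed.

HB.instance Definition _ := isGroup.Build braid braid_mulA braid_mul1g
  braid_mulg1 braid_mulVg braid_mulgV.

End BraidGroup.

Section Closure.
Variables (n : nat) (w : braid_word n).

Lemma pos_right_subproof (i : 'I_n.-1) : i.+1 < n.
Proof. by case: n i => [[]|m i] //=; rewrite ltnS. Qed.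

Definition pos_left (i : 'I_n.-1) : 'I_n := widen_ord (leq_pred n) i.
Definition pos_right (i : 'I_n.-1) : 'I_n := Ordinal (pos_right_subproof i).

(* In sigma_i the over-strand goes from upper left to lower right and the
   under-strand from upper right to lower left (a crossing of sign +1); in its
   inverse the over-strand goes from upper right to lower left and the
   under-strand from upper left to lower right (sign -1). *)
Definition over_top (l : 'I_n.-1 * bool) : 'I_n :=
  if l.2 then pos_left l.1 else pos_right l.1.
Definition over_bottom (l : 'I_n.-1 * bool) : 'I_n :=
  if l.2 then pos_right l.1 else pos_left l.1.
Definition under_top (l : 'I_n.-1 * bool) : 'I_n := over_bottom l.
Definition under_bottom (l : 'I_n.-1 * bool) : 'I_n := over_top l.

(* The letters of [w] are stacked downwards, the k-th one lying between the
   levels k and k + 1; [(k, p)] is the point of the braid at level k in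
   position p. *)
Definition braid_point : finType := ('I_(size w).+1 * 'I_n)%type.

Definition above (k : 'I_(size w)) : 'I_(size w).+1 := widen_ord (leqnSn _) k.
Definition below (k : 'I_(size w)) : 'I_(size w).+1 := lift ord0 k.

Definition letter (k : 'I_(size w)) : 'I_n.-1 * bool := tnth (in_tuple w) k.

(* [t] comes right after [s] along the closed braid, without passing under
   another strand. *)
Definition same_arc_step (s t : braid_point) : bool :=
  [exists k : 'I_(size w),
     [&& s.1 == above k, t.1 == below k &
         if s.2 == over_top (letter k) then t.2 == over_bottom (letter k)
         else (s.2 != under_top (letter k)) && (t.2 == s.2)]]
  || [&& s.1 == ord_max, t.1 == ord0 & t.2 == s.2].

Definition arc_points (s : braid_point) : {set braid_point} :=
  [set t | connect (fun x y => same_arc_step x y || same_arc_step y x) s t].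

Definition closure_arc : finType :=
  {A : {set braid_point} | A \in [set arc_points s | s : braid_point]}.

Lemma arc_of_subproof (s : braid_point) :
  arc_points s \in [set arc_points s | s : braid_point].
Proof. exact: imset_f. Qed.

Definition arc_of (s : braid_point) : closure_arc :=
  exist _ (arc_points s) (arc_of_subproof s).

Definition word_closure : diagram := {|
  arcs := closure_arc;
  crossings := 'I_(size w);
  under_in k := arc_of (above k, under_top (letter k));
  under_out k := arc_of (below k, under_bottom (letter k));
  over k := arc_of (above k, over_top (letter k));
  positive k := (letter k).2
|}.

End Closure.

(* A diagram of the closure of [x], drawn from a chosen word representing [x];
   other words give other diagrams of the same link. *)
Definition braid_closure (n : nat) (x : braid n) : diagram :=
  word_closure (quot_repr x).

Record normal_subgroup (G : groupType) := NormalSubgroup {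
  ns_set :> set G;
  ns_1 : ns_set 1;
  ns_mul : forall x y, ns_set x -> ns_set y -> ns_set (x * y);
  ns_inv : forall x, ns_set x -> ns_set x^-1;
  ns_conj : forall x y, ns_set x -> ns_set (x ^ y)
}.

Section QuotientGroup.
Local Open Scope quotient_scope.
Variables (G : groupType) (N : normal_subgroup G).

Definition same_coset (x y : G) : bool := `[< ns_set N (x^-1 * y) >].

Lemma same_coset_refl : reflexive same_coset.
Proof. by move=> x; apply/asboolP; rewrite mulVg; exact: ns_1. Qed.

Lemma same_coset_sym : symmetric same_coset.
Proof.
by move=> x y; apply/asboolP/asboolP => /ns_inv; rewrite invgM invgK.
Qed.

Lemma same_coset_trans : transitive same_coset.
Proof.
move=> y x z /asboolP xy /asboolP yz; apply/asboolP.
by have := ns_mul xy yz; rewrite mulgA mulgK.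
Qed.

Canonical same_coset_equiv :=
  EquivRel same_coset same_coset_refl same_coset_sym same_coset_trans.

Definition quo : Type := {eq_quot same_coset}.

HB.instance Definition _ := Choice.on quo.
HB.instance Definition _ := EqQuotient.on quo.

Definition quo_class (x : G) : quo := \pi x.

Definition quo_one : quo := quo_class 1.
Definition quo_mul (x y : quo) : quo := quo_class (quot_repr x * quot_repr y).
Definition quo_inv (x : quo) : quo := quo_class (quot_repr x)^-1.

Lemma quo_classP x y : quo_class x = quo_class y <-> ns_set N (x^-1 * y).
Proof. by split=> [/eqmodP/asboolP //|xy]; apply/eqmodP/asboolP. Qed.

Lemma quo_class_repr x : quo_class (quot_repr x) = x.
Proof. exact: reprK. Qed.

Lemma repr_quo_class x : ns_set N ((quot_repr (quo_class x))^-1 * x).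
Proof. by apply/quo_classP; rewrite quo_class_repr. Qed.

Lemma quo_classM x y : quo_mul (quo_class x) (quo_class y) = quo_class (x * y).
Proof.
apply/quo_classP; set x' := quot_repr _; set y' := quot_repr _.
have -> : (x' * y')^-1 * (x * y) = (x'^-1 * x) ^ y' * (y'^-1 * y).
  by rewrite invgM conjgE -!mulgA mulKVg.
by apply: ns_mul; [apply: ns_conj|]; exact: repr_quo_class.
Qed.

Lemma quo_classV x : quo_inv (quo_class x) = quo_class x^-1.
Proof.
apply/quo_classP; set x' := quot_repr _; rewrite invgK.
have -> : x' * x^-1 = ((x'^-1 * x)^-1) ^ x'^-1.
  by rewrite conjgE invgK invgM invgK -!mulgA mulgV mulg1.
by apply/ns_conj/ns_inv/repr_quo_class.
Qed.

Lemma quo_mulA : associative quo_mul.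
Proof.
move=> x y z; rewrite -[x]quo_class_repr -[y]quo_class_repr.
by rewrite -[z]quo_class_repr !quo_classM mulgA.
Qed.

Lemma quo_mul1g : left_id quo_one quo_mul.
Proof. by move=> x; rewrite -[x]quo_class_repr quo_classM mul1g. Qed.

Lemma quo_mulg1 : right_id quo_one quo_mul.
Proof. by move=> x; rewrite -[x]quo_class_repr quo_classM mulg1. Qed.

Lemma quo_mulVg : left_inverse quo_one quo_inv quo_mul.
Proof. by move=> x; rewrite -[x]quo_class_repr quo_classV quo_classM mulVg. Qed.

Lemma quo_mulgV : right_inverse quo_one quo_inv quo_mul.
Proof. by move=> x; rewrite -[x]quo_class_repr quo_classV quo_classM mulgV. Qed.

HB.instance Definition _ := isGroup.Build quo quo_mulA quo_mul1g
  quo_mulg1 quo_mulVg quo_mulgV.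

End QuotientGroup.

Section ProfiniteCompletion.
Local Open Scope classical_set_scope.
Variable G : groupType.

Record fi_normal := FiNormal {
  fi_ns :> normal_subgroup G;
  fi_finite : finite_set [set: quo fi_ns]
}.

Definition quo_prod : topologicalType :=
  prod_topology (fun N : fi_normal => discrete_topology (quo N)).

(* For N included in M, [quo_class M (quot_repr _)] is the projection of G/N onto
   G/M. *)
Definition compatible : set quo_prod :=
  [set x | forall N M : fi_normal, ns_set N `<=` ns_set M ->
             quo_class M (quot_repr (x N : quo N)) = x M].

(* [set_type] carries the topology induced by the product. *)
Definition profinite : Type := set_type compatible.

HB.instance Definition _ := Topological.on profinite.

Definition prof_coord (x : profinite) (N : fi_normal) : quo N := set_val x N.

Lemma prof_ext (x y : profinite) :
  (forall N, prof_coord x N = prof_coord y N) -> x = y.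
Proof. by move=> xy; apply: val_inj; exact: functional_extensionality_dep. Qed.

Lemma prof_compat (x : profinite) (N M : fi_normal) :
  ns_set N `<=` ns_set M -> quo_class M (quot_repr (prof_coord x N)) = prof_coord x M.
Proof. by case: x => x xP; move/set_mem: (xP) => /[apply]. Qed.

Lemma quo_class_proj (N M : fi_normal) (x : G) : ns_set N `<=` ns_set M ->
  quo_class M (quot_repr (quo_class N x)) = quo_class M x.
Proof. by move=> NM; apply/quo_classP/NM/repr_quo_class. Qed.

Definition prof_mk (x : forall N : fi_normal, quo N)
  (xP : forall N M : fi_normal, ns_set N `<=` ns_set M ->
          quo_class M (quot_repr (x N)) = x M) : profinite :=
  exist _ (x : quo_prod) (mem_set xP).

Lemma prof_of_subproof (g : G) (N M : fi_normal) : ns_set N `<=` ns_set M ->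
  quo_class M (quot_repr (quo_class N g)) = quo_class M g.
Proof. exact: quo_class_proj. Qed.

Definition prof_of (g : G) : profinite := prof_mk (prof_of_subproof g).

Lemma prof_mul_subproof (x y : profinite) (N M : fi_normal) :
  ns_set N `<=` ns_set M ->
  quo_class M (quot_repr (prof_coord x N * prof_coord y N))
    = prof_coord x M * prof_coord y M.
Proof.
move=> NM; rewrite -(prof_compat x NM) -(prof_compat y NM).
exact: etrans (quo_class_proj _ NM) (esym (quo_classM _ _ _)).
Qed.

Definition prof_one : profinite := prof_of 1.
Definition prof_mul (x y : profinite) : profinite :=
  prof_mk (@prof_mul_subproof x y).

Lemma prof_inv_subproof (x : profinite) (N M : fi_normal) :
  ns_set N `<=` ns_set M ->
  quo_class M (quot_repr ((prof_coord x N)^-1)) = (prof_coord x M)^-1.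
Proof.
move=> NM; rewrite -(prof_compat x NM).
exact: etrans (quo_class_proj _ NM) (esym (quo_classV _ _)).
Qed.

Definition prof_inv (x : profinite) : profinite :=
  prof_mk (@prof_inv_subproof x).

Lemma prof_mulA : associative prof_mul.
Proof. by move=> x y z; apply: prof_ext => N; exact: mulgA. Qed.

Lemma prof_mul1g : left_id prof_one prof_mul.
Proof. by move=> x; apply: prof_ext => N; exact: mul1g. Qed.

Lemma prof_mulg1 : right_id prof_one prof_mul.
Proof. by move=> x; apply: prof_ext => N; exact: mulg1. Qed.

Lemma prof_mulVg : left_inverse prof_one prof_inv prof_mul.
Proof. by move=> x; apply: prof_ext => N; exact: mulVg. Qed.

Lemma prof_mulgV : right_inverse prof_one prof_inv prof_mul.
Proof. by move=> x; apply: prof_ext => N; exact: mulgV. Qed.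

HB.instance Definition _ := isGroup.Build profinite prof_mulA prof_mul1g
  prof_mulg1 prof_mulVg prof_mulgV.
HB.instance Definition _ := isPointed.Build profinite prof_one.

Definition borel_profinite := g_sigma_algebraType (@open profinite).

(* Haar measure of total mass 1 (the total mass is part of [probability]).
   The group being compact, left translation invariance determines it. *)
Definition is_haar (R : realType) (mu : probability borel_profinite R) : Prop :=
  forall (g : profinite) (A : set profinite),
    measurable (A : set borel_profinite) ->
    mu [set g * x | x in A] = mu A.

(* The library's topology on nat is the discrete one. *)
Definition continuous_extension (f : G -> nat) (c : profinite -> nat) : Prop :=
  continuous c /\ forall g, c (prof_of g) = f g.

End ProfiniteCompletion.

(* [size 0] is 0, so the zero polynomial has degree -1. *)
Definition degree (R : nzRingType) (p : {poly R}) : int :=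
  ((size p)%:Z - 1)%R.

(* Main.v *)
(* Colorings of the closure of a braid s are the fixed points of s in the Hurwitz
   action (a, b) -> (a ▷ b, a) of B_n on Q^n, and dominant colorings are the fixed
   points that generate Q.  This action has finite image, so by invariance of the
   Haar measure and Burnside's lemma the two integrals are the numbers of orbits
   of B_n on Q^n and on the set of generating n-tuples.

   Write k = |pi0 Q|.  The number of entries of a tuple in each component of Q is
   invariant, and every large enough prescription of these numbers is realized by
   a generating tuple: this gives at least about n^(k-1) orbits.  Conversely let m
   be such that all phi_x^m are trivial.  A block x^m commutes with every tuple,
   and in the presence of a generating tuple t one has x^m t ~ (y ▷ x)^m t, so
   that only the component of x matters.  By pigeonhole a long generating tuple
   contains some x more than m times, so a block can be split off with a
   generating remainder.  Hence an orbit is determined by the numbers of blocks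
   of each component and by a remainder of bounded length, which leaves
   O(n^(k-1)) orbits.  Finally each tuple generates a unique sub-quandle, so the
   orbits on Q^n are counted by summing over all sub-quandles. *)
Require Import Defs.
From mathcomp Require Import all_boot all_order all_fingroup all_algebra.
From mathcomp Require Import cyclic zify.
From mathcomp.real_closed Require polyrcf.
From mathcomp Require Import finmap all_classical all_reals all_analysis.

Set Implicit Arguments.
Unset Strict Implicit.
Unset Printing Implicit Defensive.

Import GroupScope.

(** * Hurwitz equivalence of words in a quandle *)

Section QuandleBasics.
Variable Q : finQuandleType.
Implicit Types (x y z : Q) (s t u v : seq Q) (S : {set Q}).

(** A common exponent of all the permutations phi_x. The order of the whole symmetric group is a
    crude choice, but every phi_x raised to it is trivial. *)
Definition inn_exp : nat := #|[set: {perm Q}]|.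

Lemma inn_exp_gt0 : 0 < inn_exp.
Proof. exact: cardG_gt0. Qed.

Lemma qop_inj x : injective (qop x).
Proof. exact: bij_inj (qop_bij x). Qed.

Lemma iter_inn_exp x y : iter inn_exp (qop x) y = y.
Proof.
have -> : iter inn_exp (qop x) y = iter inn_exp (inner x) y.
  by elim: inn_exp => //= k ->; rewrite permE.
by rewrite -permX expg_cardG ?inE // perm1.
Qed.

Definition qdiv x y : Q := iter inn_exp.-1 (qop x) y.

Lemma qdivK x y : x ▷ qdiv x y = y.
Proof. by rewrite /qdiv -iterS prednK ?inn_exp_gt0 // iter_inn_exp. Qed.

Lemma qopK x y : qdiv x (x ▷ y) = y.
Proof. by apply: (@qop_inj x); rewrite qdivK. Qed.

Lemma qop_surj x y : exists z, x ▷ z = y.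
Proof. by exists (qdiv x y); exact: qdivK. Qed.

Definition sqclosed S := [forall x in S, forall y in S, x ▷ y \in S].

Lemma sqclosedP S :
  reflect (forall x y, x \in S -> y \in S -> x ▷ y \in S) (sqclosed S).
Proof.
apply: (iffP forallP) => [h x y xS yS|h x].
  by have /implyP/(_ xS)/forallP/(_ y)/implyP := h x; apply.
by apply/implyP => xS; apply/forallP => y; apply/implyP; exact: h.
Qed.

(** By finiteness phi_x^-1 is a power of phi_x, so a subset closed under the operation is also
    closed under the inverse maps. *)
Lemma sqclosed_qop S x y : sqclosed S -> x \in S -> (x ▷ y \in S) = (y \in S).
Proof.
move=> /sqclosedP cS xS; apply/idP/idP; last exact: cS.
move=> xyS; rewrite -(iter_inn_exp x y) -(prednK inn_exp_gt0) iterSr.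
by elim: inn_exp.-1 => //= k; exact: cS.
Qed.

Definition generates s :=
  [forall S : {set Q}, sqclosed S ==> all [in S] s ==> (S == [set: Q])].

Lemma generatesP s :
  reflect (forall S, sqclosed S -> {subset s <= S} -> S = [set: Q]) (generates s).
Proof.
apply: (iffP forallP) => [h S cS sS|h S].
  by apply/eqP; have /implyP/(_ cS)/implyP := h S; apply; apply/allP.
by apply/implyP => cS; apply/implyP => /allP sS; apply/eqP; exact: h.
Qed.

Definition component : finType := {c : {set Q} | c \in pi0 Q}.

Lemma card_component : #|component| = #|pi0 Q|.
Proof. by rewrite card_sig; apply: eq_card. Qed.

Lemma orbit_in_pi0 x : orbit 'P (Inn Q) x \in pi0 Q.
Proof. exact: imset_f. Qed.

Definition component_of x : component :=
  exist (fun c => c \in pi0 Q) _ (orbit_in_pi0 x).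

Lemma component_ofP x y :
  reflect (component_of x = component_of y) (y \in orbit 'P (Inn Q) x).
Proof.
rewrite orbit_sym -orbit_eq_mem.
by apply: (iffP eqP) => [xy|/(congr1 val)]; [apply: val_inj|].
Qed.

Lemma component_of_qop x y : component_of (x ▷ y) = component_of y.
Proof.
apply/esym/component_ofP; apply/orbitP; exists (inner x); last by rewrite /= /aperm permE.
by apply/mem_gen/imset_f.
Qed.

Lemma component_repr (c : component) : exists x, component_of x == c.
Proof.
case: c => c c_pi; have /imsetP[x _ cx] := c_pi.
by exists x; apply/eqP/val_inj.
Qed.

Definition crepr (c : component) : Q := xchoose (component_repr c).

Lemma creprK : cancel crepr component_of.
Proof. by move=> c; apply/eqP/(xchooseP (component_repr c)). Qed.

End QuandleBasics.

Section HurwitzWords.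
Variable Q : finQuandleType.
Implicit Types (x y z : Q) (s t u v : seq Q).
Local Notation m := (inn_exp Q).

(** Stated on words rather than tuples, so that concatenation and blocks need no bookkeeping of
    lengths. On words of length n the classes are the orbits of the Hurwitz action ([orbitHE]). *)
Inductive hurwitz_eq : seq Q -> seq Q -> Prop :=
| HE_refl s : hurwitz_eq s s
| HE_sym s t : hurwitz_eq s t -> hurwitz_eq t s
| HE_trans t s u : hurwitz_eq s t -> hurwitz_eq t u -> hurwitz_eq s u
| HE_swap u v x y :
    hurwitz_eq (u ++ [:: x, y & v]) (u ++ [:: x ▷ y, x & v]).

Local Notation "s ~ t" := (hurwitz_eq s t) (at level 70).

Lemma HE_ctx u v s t : s ~ t -> u ++ s ++ v ~ u ++ t ++ v.
Proof.
elim=> {s t} [s|s t _|t s w _ st _|a b x y]; first exact: HE_refl.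
- exact: HE_sym.
- exact: HE_trans.
- by have := HE_swap (u ++ a) (b ++ v) x y; rewrite -!catA.
Qed.

Lemma HE_catl u s t : s ~ t -> u ++ s ~ u ++ t.
Proof. by move/(HE_ctx u [::]); rewrite !cats0. Qed.

Lemma HE_catr v s t : s ~ t -> s ++ v ~ t ++ v.
Proof. exact: HE_ctx [::] v s t. Qed.

Lemma HE_cons x s t : s ~ t -> x :: s ~ x :: t.
Proof. exact: HE_catl [:: x] s t. Qed.

Lemma HE_size s t : s ~ t -> size s = size t.
Proof.
by elim=> {s t} // [t s u _ -> //|u v x y]; rewrite !size_cat.
Qed.

(** A swap keeps [x] and turns [y] into [x ▷ y]; once [x] is in [S], these two lie in [S]
    together. *)
Lemma HE_subset (S : {set Q}) s t :
  sqclosed S -> s ~ t -> all [in S] s = all [in S] t.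
Proof.
move=> cS; elim=> {s t} // [t s u _ -> //|u v x y].
rewrite !all_cat /=; congr (_ && _); case: (boolP (x \in S)) => xS /=.
  by rewrite sqclosed_qop.
by rewrite andbF.
Qed.

Lemma HE_generates s t : s ~ t -> generates s = generates t.
Proof.
move=> st; apply: eq_forallb => S; case: (boolP (sqclosed S)) => //= cS.
by rewrite (HE_subset cS st).
Qed.

Lemma HE_nseq_pass j x y : nseq j x ++ [:: y] ~ iter j (qop x) y :: nseq j x.
Proof.
elim: j => [|j IHj]; first exact: HE_refl.
apply: (HE_trans (t := [:: x, iter j (qop x) y & nseq j x])).
  exact: HE_cons.
exact: (HE_swap [::]).
Qed.

(** A letter [y] crossing the block to its left is changed by phi_x^m, which is the identity. *)
Lemma HE_block_central x s : nseq m x ++ s ~ s ++ nseq m x.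
Proof.
elim: s => [|y s IHs]; first by rewrite cats0; exact: HE_refl.
apply: HE_trans (HE_cons y IHs); rewrite -cat1s catA.
have := HE_nseq_pass m x y; rewrite iter_inn_exp.
exact: HE_catr.
Qed.

Lemma HE_pass_nseq j x y : y :: nseq j x ~ rcons (nseq j (y ▷ x)) y.
Proof.
elim: j => [|j IHj]; first exact: HE_refl.
apply: (HE_trans (t := [:: y ▷ x, y & nseq j x])); first exact: (HE_swap [::]).
exact: HE_cons.
Qed.

(** The block is first moved next to an occurrence of [y]. Taking [y] to its left changes nothing,
    by centrality; taking [y] back to the right by swaps applies phi_y to each entry of the
    block. *)
Lemma HE_block_conj x y s :
  y \in s -> nseq m x ++ s ~ nseq m (y ▷ x) ++ s.
Proof.
move=> /splitPr[s1 s2].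
apply: (HE_trans (t := s1 ++ nseq m x ++ y :: s2)).
  by rewrite !catA; apply/HE_catr/HE_block_central.
apply: (HE_trans (t := s1 ++ nseq m (y ▷ x) ++ y :: s2)); last first.
  by rewrite !catA; apply/HE_sym/HE_catr/HE_block_central.
apply: HE_catl; rewrite -[y :: s2]cat1s !catA; apply: HE_catr.
apply: (HE_trans (t := y :: nseq m x)); first exact: HE_block_central.
by have := HE_pass_nseq m x y; rewrite -cats1.
Qed.

Lemma HE_block_orbit x x' s : generates s ->
  component_of x = component_of x' -> nseq m x ++ s ~ nseq m x' ++ s.
Proof.
move=> /generatesP gs /component_ofP/orbitP[g gInn <-].
(* The letters whose action on a block is invisible beside [s] form a sub-quandle by (Q3). It
   contains the letters of [s], hence is all of [Q]. *)
pose T := [set y | `[< forall x, nseq m x ++ s ~ nseq m (y ▷ x) ++ s >]].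
have TT : T = [set: Q].
  apply: gs => [|y ys]; last first.
    by rewrite inE; apply/asboolP => z; exact: HE_block_conj.
  apply/sqclosedP => y z; rewrite !inE => /asboolP yP /asboolP zP.
  apply/asboolP => w; have [v <-] := qop_surj y w; rewrite -qop_dist.
  exact: HE_trans (HE_sym (yP v)) (HE_trans (zP v) (yP _)).
(* The same property for permutations defines a subgroup; it contains every phi_y, hence [Inn Q]. *)
pose A := [set h : {perm Q} | `[< forall x, nseq m x ++ s ~ nseq m (h x) ++ s >]].
have gA : group_set A.
  apply/group_setP; split=> [|h k]; rewrite !inE.
    by apply/asboolP => z; rewrite perm1; exact: HE_refl.
  move=> /asboolP hP /asboolP kP; apply/asboolP => z.
  by rewrite permM; exact: HE_trans (hP z) (kP _).
have : Inn Q \subset Group gA.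
  rewrite gen_subG; apply/fintype.subsetP => _ /imsetP[y _ ->]; rewrite inE.
  apply/asboolP => z; rewrite permE.
  by have : y \in T by [rewrite TT inE]; rewrite inE => /asboolP.
by move=> /fintype.subsetP/(_ g gInn); rewrite inE => /asboolP.
Qed.

(** Inverse swaps carry [y] to the right: each one applies phi_x^-1 to the moving letter and leaves
    [x] intact. *)
Lemma HE_cons_nseq j x y : exists z, y :: nseq j x ~ rcons (nseq j x) z.
Proof.
elim: j y => [|j IHj] y; first by exists y; exact: HE_refl.
have [w xw] := qop_surj x y; have [z wz] := IHj w; exists z.
apply: (HE_trans (t := [:: x, w & nseq j x])); last exact: HE_cons.
by apply: HE_sym; have := HE_swap [::] (nseq j x) x w; rewrite xw.
Qed.

Lemma HE_collect x s : exists t, s ~ nseq (count_mem x s) x ++ t.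
Proof.
elim: s => [|y s [t IHs]]; first by exists [::]; exact: HE_refl.
rewrite /=; case: eqVneq => [->|_] /=; first by exists t; exact: HE_cons.
have [z yz] := HE_cons_nseq (count_mem x s) x y.
exists (z :: t); apply: HE_trans (HE_cons y IHs) _.
by rewrite -cat_rcons; exact: HE_catr yz.
Qed.

Lemma HE_extract s : generates s -> #|Q| * m < size s ->
  exists c t, [/\ generates t & s ~ nseq m (crepr c) ++ t].
Proof.
move=> gs s_big.
have [x mx] : exists x, m < count_mem x s.
  apply/existsP; apply: contraLR s_big; rewrite negb_exists => /forallP small.
  rewrite -leqNgt.
  have -> : size s = \sum_(x : Q) count_mem x s.
    elim: s {gs small} => [|y s IHs] /=; first by rewrite big1.
    rewrite big_split /= -IHs (bigD1 y) //= eqxx big1 // => x.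
    by rewrite eq_sym => /negPf->.
  by rewrite -sum_nat_const; apply: leq_sum => x _; rewrite leqNgt.
have [t st] := HE_collect x s; pose r := nseq (count_mem x s - m) x ++ t.
have sr : s ~ nseq m x ++ r.
  by rewrite catA -nseqD subnKC // ltnW.
have gr : generates r.
  (* As [x] occurs more than [m] times, a copy of it stays in [r]; so a sub-quandle containing [r]
     contains the removed block too. *)
  apply/generatesP => S cS rS; move: gs; rewrite (HE_generates sr).
  move=> /generatesP; apply=> // y; rewrite mem_cat => /orP[|/rS //].
  rewrite mem_nseq => /andP[_ /eqP->]; apply: rS.
  by rewrite mem_cat mem_nseq subn_gt0 mx eqxx.
exists (component_of x), r; split=> //; apply: HE_trans sr _.
by apply: HE_block_orbit => //; rewrite creprK.
Qed.

Definition blocks (l : seq (component Q)) : seq Q :=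
  flatten [seq nseq m (crepr c) | c <- l].

Lemma size_blocks l : size (blocks l) = (m * size l)%N.
Proof.
elim: l => [|c l IHl]; first by rewrite muln0.
by rewrite /blocks /= size_cat -/(blocks l) IHl size_nseq mulnS.
Qed.

Lemma blocks_cat l l' : blocks (l ++ l') = blocks l ++ blocks l'.
Proof. by rewrite /blocks map_cat flatten_cat. Qed.

Lemma HE_blocks_central l s : blocks l ++ s ~ s ++ blocks l.
Proof.
elim: l s => [|c l IHl] s; first by rewrite cats0; exact: HE_refl.
rewrite /blocks /= -/(blocks l) -catA.
apply: HE_trans (HE_catl _ (IHl s)) _; rewrite !catA.
exact/HE_catr/HE_block_central.
Qed.

Lemma HE_blocks_perm l l' : perm_eq l l' -> blocks l ~ blocks l'.
Proof.
move=> pll'; apply: (@catCA_perm_ind _ (fun r => blocks l ~ blocks r)) pll' _.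
  move=> a b c lbc; apply: HE_trans lbc _; rewrite !blocks_cat !catA.
  exact/HE_catr/HE_blocks_central.
exact: HE_refl.
Qed.

(* Blocks are central and depend on their component only, so an orbit of
   generating tuples is determined by the number of blocks of each component and
   by a remainder of bounded length. *)
Lemma HE_normal_form s : generates s ->
  exists l t, size t <= #|Q| * m /\ s ~ blocks l ++ t.
Proof.
have [n] := ubnP (size s); elim: n s => // n IHn s; rewrite ltnS => sn gs.
have [small|big] := leqP (size s) (#|Q| * m).
  by exists [::], s; split=> //; exact: HE_refl.
have [c [t [gt st]]] := HE_extract gs big.
have [|l [r [r_small tr]]] := IHn t _ gt.
  have := HE_size st; rewrite size_cat size_nseq => s_t.
  by move: sn; rewrite s_t; apply: leq_trans; rewrite -add1n leq_add2r inn_exp_gt0.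
exists (c :: l), r; split=> //; apply: HE_trans st _.
by rewrite /blocks /= -catA; exact: HE_catl.
Qed.

End HurwitzWords.

(** * Hurwitz action and its orbits *)

Section HurwitzAction.
Variables (Q : finQuandleType) (n : nat).
Implicit Types (t : n.-tuple Q) (i : 'I_n.-1) (p : 'I_n) (w : braid_word n).

Lemma pos_left_neq_right i : (pos_left i == pos_right i) = false.
Proof. by apply/eqP => /(congr1 val) /= /eqP; rewrite ltn_eqF. Qed.

Definition hswap i t : n.-tuple Q :=
  [tuple if p == pos_left i then tnth t (pos_left i) ▷ tnth t (pos_right i)
         else if p == pos_right i then tnth t (pos_left i)
         else tnth t p | p < n].

Lemma tnth_hswap i t p : tnth (hswap i t) p =
  if p == pos_left i then tnth t (pos_left i) ▷ tnth t (pos_right i)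
  else if p == pos_right i then tnth t (pos_left i) else tnth t p.
Proof. by rewrite tnth_mktuple. Qed.

Lemma hswap_left i t :
  tnth (hswap i t) (pos_left i) = tnth t (pos_left i) ▷ tnth t (pos_right i).
Proof. by rewrite tnth_hswap eqxx. Qed.

Lemma hswap_right i t : tnth (hswap i t) (pos_right i) = tnth t (pos_left i).
Proof. by rewrite tnth_hswap eq_sym pos_left_neq_right eqxx. Qed.

Lemma hswap_other i t p :
  p != pos_left i -> p != pos_right i -> tnth (hswap i t) p = tnth t p.
Proof. by rewrite tnth_hswap => /negPf-> /negPf->. Qed.

Lemma hswap_inj i : injective (hswap i).
Proof.
move=> t u tu; have tl : tnth t (pos_left i) = tnth u (pos_left i).
  by rewrite -hswap_right tu hswap_right.
apply: eq_from_tnth => p; case: (eqVneq p (pos_left i)) => [->//|pl].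
case: (eqVneq p (pos_right i)) => [->|pr]; last first.
  by rewrite -(hswap_other t pl pr) tu hswap_other.
by apply: (@qop_inj Q (tnth t (pos_left i))); rewrite -hswap_left tu hswap_left tl.
Qed.

Definition hperm i : {perm n.-tuple Q} := perm (@hswap_inj i).

Definition letter_perm (l : 'I_n.-1 * bool) : {perm n.-tuple Q} :=
  if l.2 then hperm l.1 else (hperm l.1)^-1.

Definition word_perm w : {perm n.-tuple Q} := \prod_(l <- w) letter_perm l.

Lemma word_perm_cat w w' : word_perm (w ++ w') = word_perm w * word_perm w'.
Proof. exact: big_cat. Qed.

Definition hgroup : {group {perm n.-tuple Q}} := <<[set hperm i | i : 'I_n.-1]>>%G.

Lemma word_perm_hgroup w : word_perm w \in hgroup.
Proof.
apply: group_prod => -[i b] _; have h : hperm i \in hgroup.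
  by apply/mem_gen/imset_f.
by case: b; rewrite ?groupV.
Qed.

Lemma hgroupP g : reflect (exists w, g = word_perm w) (g \in hgroup).
Proof.
apply: (iffP idP) => [|[w ->]]; last exact: word_perm_hgroup.
(* In a finite group products of generators suffice, without inverses, so a word in positive letters
   is found. *)
move=> /gen_prodgP[k [c cP ->]].
have {}cP j : exists i, c j = hperm i by have /imsetP[i _ ->] := cP j; exists i.
have [i ci] := boolp.choice cP.
exists [seq (i j, true) | j <- index_enum 'I_k].
by rewrite /word_perm big_map; apply: eq_bigr => j _; rewrite ci.
Qed.

(** The coloring rule at a crossing, for both signs: [t] holds the colors above the letter and its
    image those below. For a negative letter the rule is written without phi^-1, as an equation for
    the color above. *)
Lemma tnth_letter_perm l t p :
  (tnth (letter_perm l t) (over_bottom l) = tnth t (over_top l)) /\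
  (if l.2 then tnth (letter_perm l t) (under_bottom l)
                = tnth t (over_top l) ▷ tnth t (under_top l)
   else tnth t (over_top l) ▷ tnth (letter_perm l t) (under_bottom l)
        = tnth t (under_top l)) /\
  (p != over_top l -> p != under_top l -> tnth (letter_perm l t) p = tnth t p).
Proof.
case: l => i [] /=; rewrite /letter_perm /over_bottom /over_top /under_bottom
  /under_top /over_top /over_bottom /=.
  by rewrite permE hswap_left hswap_right; split=> //; split=> //; exact: hswap_other.
have [u ->] : exists u, t = hperm i u by exists ((hperm i)^-1 t); rewrite permKV.
rewrite permK permE hswap_left hswap_right; split=> //; split=> // pr pl.
by rewrite hswap_other.
Qed.

End HurwitzAction.

Section BraidAction.
Variables (Q : finQuandleType) (n : nat).
Implicit Types (t : n.-tuple Q) (i j : 'I_n.-1) (p : 'I_n) (w : braid_word n).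

Lemma hperm_far i j : i.+1 < j -> hperm Q i * hperm Q j = hperm Q j * hperm Q i.
Proof.
move=> ij; apply/permP => t; rewrite !permM !permE.
apply: eq_from_tnth => p; rewrite !tnth_hswap.
have E (a b : 'I_n) : (a == b) = (val a == val b) by [].
rewrite !E /= ?eqxx.
have -> : (j == i :> nat) = false by lia.
have -> : (j == i.+1 :> nat) = false by lia.
have -> : (j.+1 == i :> nat) = false by lia.
have -> : (j.+1 == i.+1 :> nat) = false by lia.
have -> : (i == j :> nat) = false by lia.
have -> : (i.+1 == j :> nat) = false by lia.
have -> : (i == j.+1 :> nat) = false by lia.
have -> : (i.+1 == j.+1 :> nat) = false by lia.
do 4?[case: eqP => //= ?]; lia.
Qed.

(** Both sides send (a, b, c) to (a ▷ (b ▷ c), a ▷ b, a); the first entries agree by (Q3). *)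
Lemma hperm_braid i j : j = i.+1 :> nat ->
  hperm Q i * hperm Q j * hperm Q i = hperm Q j * hperm Q i * hperm Q j.
Proof.
move=> ij; apply/permP => t; rewrite !permM !permE.
have ji : pos_left j = pos_right i by apply: val_inj.
set l := pos_left i; set r := pos_right j; set k := pos_right i in ji *.
have [lk lr kr] : [/\ l == k = false, l == r = false & k == r = false].
  by rewrite -!val_eqE /= ij; split; lia.
have [kl rl rk] : [/\ k == l = false, r == l = false & r == k = false].
  by rewrite !(eq_sym _ l) (eq_sym r).
have E := (tnth_hswap, ji, lk, lr, kr, kl, rl, rk, eqxx).
apply: eq_from_tnth => p; rewrite !E.
rewrite -/l -/k -/r; have [->|pl] := eqVneq p l; first by rewrite ?E -qop_dist.
by case: (p == k); case: (p == r).
Qed.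


End BraidAction.

Section Orbits.
Variables (Q : finQuandleType) (n : nat).
Implicit Types (t u : n.-tuple Q) (s : seq Q) (i : 'I_n.-1).
Local Notation horbit := (orbit 'P (hgroup Q n)).

Lemma hswap_cat i t (u v : seq Q) x y :
  val t = u ++ [:: x, y & v] -> val i = size u ->
  val (hswap i t) = u ++ [:: x ▷ y, x & v].
Proof.
move=> tE iE; apply: (@eq_from_nth _ x) => [|k].
  by rewrite size_tuple -(size_tuple t) tE !size_cat.
rewrite size_tuple => kn; have := tnth_hswap i t (Ordinal kn).
rewrite !(tnth_nth x) /= tE -!val_eqE /= iE => ->.
rewrite !nth_cat ltnn subnn ltnNge leqnSn /= subSnn /=.
case: (ltngtP k (size u)) => [ku|ku|->]; last by rewrite subnn.
  by rewrite ltn_eqF // ltnW.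
case: eqVneq => [->|ku']; first by rewrite subSnn.
have -> : (k - size u = (k - (size u).+2).+2)%N by lia.
by [].
Qed.

Lemma HE_hswap i t : hurwitz_eq t (hswap i t).
Proof.
have i1 : i.+1 < size t by rewrite size_tuple; exact: pos_right_subproof.
have x : Q by exact: tnth t (pos_left i).
have tE : val t = take i t ++ [:: nth x t i, nth x t i.+1 & drop i.+2 t].
  by rewrite -(drop_nth _ i1) -(drop_nth _ (ltnW i1)) cat_take_drop.
rewrite (hswap_cat tE) ?size_takel ?(ltnW (ltnW i1)) //.
by rewrite {1}tE; exact: HE_swap.
Qed.

Lemma HE_of_orbit t u : u \in horbit t -> hurwitz_eq t u.
Proof.
case/orbitP => g /hgroupP[w ->] <- {u g}.
elim: w t => [|l w IHw] t; rewrite /word_perm ?big_nil ?big_cons /= /aperm.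
  by rewrite perm1; exact: HE_refl.
rewrite permM; apply: HE_trans (IHw _).
case: l => i [] /=; rewrite /letter_perm /=; first by rewrite permE; exact: HE_hswap.
by apply: HE_sym; have := HE_hswap i ((hperm Q i)^-1 t); rewrite -(permE (@hswap_inj Q n i)) permKV.
Qed.

(** The tuples are quantified after the words to allow induction on [hurwitz_eq]. In a transitivity
    step the middle word is again an n-tuple because the length is invariant. *)
Lemma HE_orbit s s' : hurwitz_eq s s' ->
  forall t t', val t = s -> val t' = s' -> t' \in horbit t.
Proof.
elim=> {s s'} [s|s s' _ IH|s' s s'' ss' IH1 _ IH2|u v x y] t t' ts t's'.
- by rewrite (_ : t' = t) ?orbit_refl //; apply: val_inj; rewrite ts t's'.
- by rewrite orbit_sym; exact: IH.
- have s'n : size s' == n by rewrite -(HE_size ss') -ts size_tuple.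
  exact: orbit_trans (IH2 (Tuple s'n) _ _ _) (IH1 _ (Tuple s'n) _ _).
- have un : size u < n.-1.
    by rewrite -(size_tuple t) ts size_cat /= !addnS /= ltnS leq_addr.
  apply/orbitP; exists (hperm Q (Ordinal un)); first exact/mem_gen/imset_f.
  by apply: val_inj; rewrite /= /aperm permE t's' (hswap_cat ts).
Qed.

Lemma orbitHE t u : u \in horbit t <-> hurwitz_eq t u.
Proof. by split; [exact: HE_of_orbit | move=> /HE_orbit; exact]. Qed.

Definition gen_tuples : {set n.-tuple Q} := [set t : n.-tuple Q | generates t].

Definition gen_orbits := horbit @: gen_tuples.

Lemma gen_tuples_orbit t u : u \in horbit t -> (u \in gen_tuples) = (t \in gen_tuples).
Proof. by rewrite !inE => /HE_of_orbit/HE_generates. Qed.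

End Orbits.

(** * Growth of the number of orbits of generating tuples *)

Section OrbitCount.
Variable Q : finQuandleType.
Local Notation k := #|pi0 Q|.

Definition component_count (c : component Q) (s : seq Q) :=
  count (fun x => component_of x == c) s.

Lemma HE_component_count c s t :
  hurwitz_eq s t -> component_count c s = component_count c t.
Proof.
elim=> {s t} // [t s u _ -> //|u v x y].
by rewrite /component_count !count_cat /= component_of_qop (addnCA (_ == c)).
Qed.

(* The tuple attached to [h] is padded with elements of [c0] to the right
   length, so that its orbit determines [h] away from [c0] only: this is where
   the factor [j.+1] on the right comes from. *)
Lemma gen_orbits_lower j : 0 < k ->
  (j.+1 ^ k <= #|gen_orbits Q (#|Q| + k * j)| * j.+1)%N.
Proof.
rewrite -card_component => k_gt0; have /card_gt0P[c0 _] := k_gt0.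
set n := (_ + _)%N; pose F := {ffun component Q -> 'I_j.+1}.
pose W (h : F) := flatten [seq nseq (h c) (crepr c) | c <- enum (component Q)].
have sizeW h : size (W h) <= k * j.
  rewrite -card_component cardE /W; elim: (enum _) => [|c l IHl] //=.
  by rewrite size_cat size_nseq mulSn leq_add // -ltnS.
(* [enum Q] makes the tuple generating and adds the same amount to the component counts for every
   [h]. *)
pose s h := W h ++ enum Q ++ nseq (#|component Q| * j - size (W h)) (crepr c0).
have size_s h : size (s h) == n.
  rewrite !size_cat size_nseq -cardE addnCA subnKC //.
  by rewrite card_component.
pose t h : n.-tuple Q := Tuple (size_s h).
have countW h c : component_count c (W h) = h c.
  transitivity (\sum_(d <- enum (component Q)) (if d == c then h d : nat else 0)).
    rewrite /W; elim: (enum _) => [|d l IHl]; rewrite ?big_nil ?big_cons //=.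
    rewrite -IHl [LHS]count_cat; congr (_ + _)%N.
    by rewrite count_nseq creprK; case: (d == c); rewrite ?mul1n.
  by rewrite big_enum /= -big_mkcond /= big_pred1_eq.
have gs h : generates (s h).
  apply/generatesP => S _ sS; apply/setP => x; rewrite inE; apply: sS.
  by rewrite !mem_cat mem_enum inE /= orbT.
pose f (h : F) := (orbit 'P (hgroup Q n) (t h), h c0).
have f_inj : injective f.
  move=> h h' [/orbit_eqP]; rewrite orbitHE => /HE_component_count cc h0.
  apply/ffunP => c; have [->//|c_c0] := eqVneq c c0.
  apply: val_inj; have := cc c; rewrite /component_count /= !count_cat.
  rewrite -/(component_count c (W h)) -/(component_count c (W h')) !countW.
  rewrite !count_nseq creprK eq_sym (negPf c_c0) !mul0n !addn0.
  by move/addIn.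
have : #|f @: [set: F]| <= #|finset.setX (gen_orbits Q n) [set: 'I_j.+1]|.
  apply/subset_leq_card/fintype.subsetP => _ /imsetP[h _ ->].
  rewrite !inE andbT; apply: imset_f; rewrite inE; exact: gs.
by rewrite card_imset // cardsT card_ffun cardsX cardsT !card_ord.
Qed.

(* In a normal form [blocks l ++ r] the orbit only depends on [r] and on the
   multiplicities in [l], one of which is determined by [n]. *)
Lemma gen_orbits_upper : exists C, forall n, 0 < n ->
  (#|gen_orbits Q n| * n.+1 <= C * n.+1 ^ k)%N.
Proof.
pose m := inn_exp Q; pose K := (#|Q| * m)%N.
exists #|{: K.-bseq Q}| => n n_gt0.
have [-> | /finset.set0Pn[Z0 /imsetP[t0 _ _]]] := eqVneq (gen_orbits Q n) finset.set0.
  by rewrite cards0.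
pose c0 := component_of (tnth t0 (Ordinal n_gt0)).
have nf (X : {set n.-tuple Q}) : exists lr : seq (component Q) * K.-bseq Q,
    X \in gen_orbits Q n -> exists t : n.-tuple Q,
      [/\ X = orbit 'P (hgroup Q n) t, hurwitz_eq t (blocks lr.1 ++ lr.2)
        & (m * size lr.1 + size lr.2)%N = n].
  case: (boolP (X \in _)) => [/imsetP[t]|_]; last by exists ([::], [bseq]).
  rewrite inE => /HE_normal_form[l [r [rK tlr]]] ->.
  exists (l, Bseq rK) => _; exists t; split=> //=.
  by rewrite -size_blocks -size_cat -(HE_size tlr) size_tuple.
have {nf}[nf nfP] := boolp.choice nf.
(* The multiplicity of [c0] can be recovered from the total length, so its slot is free to store
   [z.2], which accounts for the factor [n.+1] on the left. *)
pose f (z : {set n.-tuple Q} * 'I_n.+1) :=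
  ([ffun c => if c == c0 then z.2
              else inord (count_mem c (nf z.1).1)] : {ffun component Q -> 'I_n.+1},
   (nf z.1).2).
have f_inj : {in finset.setX (gen_orbits Q n) [set: 'I_n.+1] &, injective f}.
  move=> [X a] [X' a'] /finset.setXP[/= XG _] /finset.setXP[/= X'G _] [/ffunP ff rr].
  have aa : a = a' by have := ff c0; rewrite !ffunE eqxx.
  have [t [Xt tlr sz]] := nfP _ XG; have [t' [Xt' tlr' sz']] := nfP _ X'G.
  have m_gt0 : 0 < m := inn_exp_gt0 Q.
  have ll : size (nf X).1 = size (nf X').1.
    apply/eqP; rewrite -(eqn_pmul2l m_gt0) -(eqn_add2r (size (nf X).2)) sz rr.
    by rewrite sz'.
  (* Multiplicities are at most [n], so [inord] does not distort them. *)
  have small (l : seq (component Q)) r c :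
      (m * size l + r)%N = n -> count_mem c l < n.+1.
    move=> <-; rewrite ltnS; apply: leq_trans (count_size _ _) _.
    by apply: leq_trans (leq_addr _ _); rewrite leq_pmull.
  have cc c : c != c0 -> count_mem c (nf X).1 = count_mem c (nf X').1.
    move=> cc0; have := ff c; rewrite !ffunE (negPf cc0) => /(congr1 val).
    by rewrite /= !inordK // ?(small _ _ _ sz) ?(small _ _ _ sz').
  have sum_count (l : seq (component Q)) : size l = \sum_c count_mem c l.
    elim: l => [|d l IHl] /=; first by rewrite big1.
    rewrite big_split /= -IHl (bigD1 d) //= eqxx big1 // => c.
    by rewrite eq_sym => /negPf->.
  have pll : perm_eq (nf X).1 (nf X').1.
    apply/allP => c _ /=; apply/eqP; have [->|/cc //] := eqVneq c c0.
    move: ll; rewrite !sum_count (bigD1 c0) //= [in RHS](bigD1 c0) //=.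
    by rewrite [X in (_ + X)%N = _](eq_bigr _ cc) => /addIn.
  congr (_, _) => //; rewrite Xt Xt'; apply/orbit_eqP/orbitHE.
  apply: HE_trans tlr' _; rewrite -rr; apply: HE_sym; apply: HE_trans tlr _.
  exact/HE_catr/HE_blocks_perm.
have : #|f @: finset.setX (gen_orbits Q n) [set: 'I_n.+1]| <= #|[set: {ffun component Q -> 'I_n.+1} * K.-bseq Q]|.
  by apply/subset_leq_card/fintype.subsetP => ? _; rewrite inE.
rewrite card_in_imset // cardsX !cardsT card_prod card_ffun card_ord.
by rewrite card_component (mulnC (_ ^ _)%N).
Qed.

End OrbitCount.

(** * From generating tuples of sub-quandles to all tuples *)

Section OrbitMap.
Variables (X Y : finQuandleType) (f : X -> Y) (n : nat).
Hypotheses (fM : quandle_morphism f) (f_inj : injective f).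
Implicit Types t u : n.-tuple X.

Lemma hswap_map i t : map_tuple f (hswap i t) = hswap i (map_tuple f t).
Proof.
apply: eq_from_tnth => p; rewrite tnth_map !tnth_hswap !tnth_map.
by case: eqP => // _; case: eqP.
Qed.

(** Naturality of the braid action in the quandle. For an inverse letter the equation is checked
    after applying [hperm]. *)
Lemma word_perm_map w t :
  map_tuple f (word_perm X w t) = word_perm Y w (map_tuple f t).
Proof.
elim: w t => [|[i b] w IHw] t; rewrite /word_perm ?big_nil ?big_cons ?perm1 //.
rewrite !permM [LHS]IHw; congr (word_perm _ _ _).
case: b; rewrite /letter_perm /=; first by rewrite !permE hswap_map.
apply: (@perm_inj _ (hperm Y i)); rewrite permKV [LHS]permE -hswap_map.
by rewrite -(permE (@hswap_inj X n i)) permKV.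
Qed.

Lemma map_orbit t : [set map_tuple f u | u in orbit 'P (hgroup X n) t]
  = orbit 'P (hgroup Y n) (map_tuple f t).
Proof.
apply/setP => v; apply/imsetP/orbitP => [[_ /orbitP[_ /hgroupP[w ->] <-] ->]|].
  by exists (word_perm Y w); [exact: word_perm_hgroup | exact: esym (word_perm_map w t)].
case=> _ /hgroupP[w ->] <-; exists (word_perm X w t); last exact: esym (word_perm_map w t).
by apply/orbitP; exists (word_perm X w) => //; exact: word_perm_hgroup.
Qed.

Lemma map_tuple_inj : injective (map_tuple f : n.-tuple X -> n.-tuple Y).
Proof. by move=> t u /(congr1 val)/(inj_map f_inj)/val_inj. Qed.

End OrbitMap.

Section Decomposition.
Variable Q : finQuandleType.
Implicit Types R : subquandle Q.

Definition all_orbits n := orbit 'P (hgroup Q n) @: [set: n.-tuple Q].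

Lemma sq_val_morphism R : quandle_morphism (val : R -> Q).
Proof. by []. Qed.

Lemma gen_orbits_sub n R : (#|gen_orbits R n| <= #|all_orbits n|)%N.
Proof.
pose F (Z : {set n.-tuple R}) : {set n.-tuple Q} :=
  [set map_tuple (val : R -> Q) u | u in Z].
have F_inj : injective F by exact/imset_inj/map_tuple_inj/val_inj.
rewrite -(card_imset _ F_inj); apply/subset_leq_card/fintype.subsetP => Z.
case/imsetP => _ /imsetP[t _ ->] ->; rewrite /F (map_orbit (@sq_val_morphism R)).
exact: imset_f.
Qed.

Lemma tuple_in_sub n (t : n.-tuple Q) : exists R (t0 : n.-tuple R),
  t0 \in gen_tuples R n /\ map_tuple (val : R -> Q) t0 = t.
Proof.
(* The sub-quandle generated by [t], as the intersection of all closed subsets containing it. *)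
pose S := [set x | [forall S : {set Q}, sqclosed S ==> all [in S] t ==> (x \in S)]].
have SP x : reflect (forall S, sqclosed S -> {subset t <= S} -> x \in S) (x \in S).
  rewrite inE; apply: (iffP forallP) => [h T cT tT|h T].
    by have /implyP/(_ cT)/implyP := h T; apply; apply/allP.
  by apply/implyP => cT; apply/implyP => /allP; exact: h.
have cS : sqclosed S.
  apply/sqclosedP => x y /SP xS /SP yS; apply/SP => T cT tT.
  by apply: (elimT (sqclosedP T) cT); [exact: xS | exact: yS].
have tS p : tnth t p \in S by apply/SP => T _; apply; exact: mem_tnth.
pose R := Subquandle cS.
pose t0 : n.-tuple R := [tuple exist (fun x => x \in sq_set R) _ (tS p) | p < n].
have t0E : map_tuple (val : R -> Q) t0 = t.
  by apply: eq_from_tnth => p; rewrite tnth_map tnth_mktuple.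
exists R, t0; split=> //; rewrite inE; apply/generatesP => T cT tT.
apply/setP => x; rewrite inE.
(* The image of [T] in [Q] is closed and contains [t], so it contains all of [S]. *)
have : val x \in [set val y | y in T].
  apply: (elimT (SP (val x)) (valP x)) => [|y].
    apply/sqclosedP => _ _ /imsetP[a aT ->] /imsetP[b bT ->].
    by apply/imsetP; exists (@sq_op Q R a b) => //; exact: (elimT (sqclosedP T) cT a b aT bT).
  by rewrite -t0E => /mapP[a /tT aT ->]; exact: imset_f.
by case/imsetP => y yT /val_inj ->.
Qed.

Lemma all_orbits_le_sum n :
  (#|all_orbits n| <= \sum_(R : subquandle Q) #|gen_orbits R n|)%N.
Proof.
pose F R (Z : {set n.-tuple R}) : {set n.-tuple Q} :=
  [set map_tuple (val : R -> Q) u | u in Z].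
have sub : all_orbits n \subset \bigcup_(R : subquandle Q) F R @: gen_orbits R n.
  apply/fintype.subsetP => _ /imsetP[t _ ->]; apply/bigcupP.
  have [R [t0 [gt0 <-]]] := tuple_in_sub t; exists R => //.
  rewrite -(map_orbit (@sq_val_morphism R)); apply: imset_f; exact: imset_f.
apply: leq_trans (subset_leq_card sub) _.
elim/big_rec2: _ => [|R a B _ IH]; first by rewrite cards0.
apply: leq_trans (leq_card_setU _ _) _; apply: leq_add IH; exact: leq_imset_card.
Qed.

Lemma all_orbits_upper : exists C, forall n, 0 < n ->
  (#|all_orbits n| * n.+1 <= C * n.+1 ^ quandle_dim Q)%N.
Proof.
have /boolp.choice[C CP] : forall R, exists C, forall n, 0 < n ->
  (#|gen_orbits R n| * n.+1 <= C * n.+1 ^ #|pi0 R|)%N.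
  by move=> R; exact: gen_orbits_upper.
exists (\sum_R C R)%N => n n_gt0.
apply: leq_trans (leq_mul (all_orbits_le_sum n) (leqnn _)) _.
rewrite !big_distrl; apply: leq_sum => R _; apply: leq_trans (CP R n n_gt0) _.
rewrite leq_mul2l leq_exp2l ?ltnS // ; apply/orP; right.
exact: (leq_bigmax R).
Qed.

(** The bound for generating tuples is applied to a sub-quandle with the most components, whose
    orbits embed in those of [Q]. The empty sub-quandle shows that the maximum is attained. *)
Lemma all_orbits_lower : 0 < quandle_dim Q -> exists a, forall j,
  (j.+1 ^ quandle_dim Q <= #|all_orbits (a + quandle_dim Q * j)| * j.+1)%N.
Proof.
have c0 : sqclosed (finset.set0 : {set Q}) by apply/sqclosedP => x y; rewrite inE.
have sq_gt0 : 0 < #|{: subquandle Q}| by apply/card_gt0P; exists (Subquandle c0).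
rewrite /quandle_dim; have [R ->] := eq_bigmax (fun R : subquandle Q => #|pi0 R|) sq_gt0.
move=> k_gt0; eexists=> j; apply: leq_trans (gen_orbits_lower j k_gt0) _.
by apply: leq_mul (leqnn _); exact: gen_orbits_sub.
Qed.

End Decomposition.

(** * Colorings of braid closures *)

(** The injection into a finite type also yields the finiteness of [A], without which [fset_set]
    would take its default value. *)
Lemma card_fset_set_image (T : choiceType) (U : finType) (A : set T)
    (f : T -> U) (B : {set U}) :
  {in A &, injective f} -> (f @` A = [set` B])%classic ->
  #|` fset_set A| = #|B|.
Proof.
move=> f_inj fA; apply: card_fset_set.
apply: (card_eq_trans _ (_ : ([set` [fset x | x in B]%fset] #= `I_#|B|)%card)).
  have := inj_card_eq f_inj; rewrite fA => /card_esym/card_eq_trans; apply.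
  have -> : [set` [fset x | x in B]%fset]%classic = [set` B]%classic.
    by apply/seteqP; split=> x /=; rewrite !inE.
  exact: card_eqxx.
by apply/card_eq_fsetP; rewrite card_imfset //= cardE.
Qed.

Lemma connect_invariant (T : finType) (e : rel T) (X : Type) (h : T -> X) x y :
  (forall x y, e x y -> h x = h y) -> connect e x y -> h x = h y.
Proof.
move=> eh /connectP[p]; elim: p x => [|z p IHp] x /=; first by move=> _ ->.
by move=> /andP[/eh -> /IHp].
Qed.

Section ClosureColorings.
Variables (Q : finQuandleType) (n : nat) (w : braid_word n).
Local Notation FQ := (fundamental_quandle (word_closure w)).
Local Notation crel := (@crossing_rel (word_closure w)).
Implicit Types (t : n.-tuple Q) (s : braid_point w) (f : FQ -> Q).

Definition qterm_class (x : qterm (closure_arc w)) : FQ := qclass crel x.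

Definition point_class s : FQ := qterm_class (QGen (arc_of s)).

Lemma quandle_morphism_op f x y : quandle_morphism f ->
  f (qterm_class (QOp x y)) = f (qterm_class x) ▷ f (qterm_class y).
Proof. by move=> <-; rewrite /qterm_class -qclass_op. Qed.

Lemma quandle_morphism_inv f x y : quandle_morphism f ->
  f (qterm_class x) ▷ f (qterm_class (QInv x y)) = f (qterm_class y).
Proof.
move=> fM; rewrite -quandle_morphism_op //; congr (f _).
by apply/qclassP; exact: QC_invK.
Qed.

Let step s s' := same_arc_step s s' || same_arc_step s' s.

Let step_sym : connect_sym step.
Proof. by apply: sym_connect_sym => s s'; rewrite /step orbC. Qed.

Lemma arc_of_step s s' : same_arc_step s s' -> arc_of s = arc_of s'.
Proof.
move=> ss'; apply: val_inj; apply/setP => u; rewrite !inE.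
by apply: (same_connect1 step_sym); rewrite /step ss'.
Qed.

Lemma arc_of_connect s s' : arc_of s = arc_of s' -> connect step s s'.
Proof.
move=> /(congr1 val)/setP/(_ s'); rewrite !inE => ->; exact: connect0.
Qed.

Lemma arc_ofP (a : closure_arc w) : exists s, arc_of s = a.
Proof.
case: a => a aP; have /imsetP[s _ as_] := aP.
by exists s; apply: val_inj; rewrite /= as_.
Qed.

(** The crossing rule determines the colors below a letter, by injectivity of phi_x in the negative
    case. *)
Lemma letter_permP (l : 'I_n.-1 * bool) t u :
    tnth u (over_bottom l) = tnth t (over_top l) ->
    (if l.2 then tnth u (under_bottom l) = tnth t (over_top l) ▷ tnth t (under_top l)
     else tnth t (over_top l) ▷ tnth u (under_bottom l) = tnth t (under_top l)) ->
    (forall p, p != over_top l -> p != under_top l -> tnth u p = tnth t p) ->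
  u = letter_perm Q l t.
Proof.
move=> over_u under_u other_u; apply: eq_from_tnth => p.
have [over_t [under_t other_t]] := tnth_letter_perm l t p.
have [->|po] := eqVneq p (over_top l).
  rewrite -/(under_bottom l); case: l.2 under_u under_t => [-> -> //|<-].
  by move/qop_inj.
have [->|pu] := eqVneq p (under_top l); first by rewrite over_u over_t.
by rewrite other_u ?other_t.
Qed.

Definition level t (k : nat) : n.-tuple Q := word_perm Q (take k w) t.

Lemma level_below t (k : 'I_(size w)) :
  level t (below k) = letter_perm Q (letter k) (level t (above k)).
Proof.
rewrite /level /= (take_nth (letter k)) // -cats1 word_perm_cat permM.
by rewrite [word_perm Q [:: _]]big_seq1 -(tnth_nth _ (in_tuple w)).
Qed.

Definition color t s : Q := tnth (level t s.1) s.2.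

Lemma color_step t s s' : word_perm Q w t = t ->
  same_arc_step s s' -> color t s = color t s'.
Proof.
case: s s' => [k p] [k' p'] wt /orP[/existsP[j /and3P[/= /eqP-> /eqP-> h]]|].
  rewrite /color /= level_below.
  have [over_t [_ other_t]] := tnth_letter_perm (letter j) (level t (above j)) p.
  move: h; case: eqVneq => [->|po] => [/eqP->|/andP[pu /eqP->]].
    by rewrite over_t.
  by rewrite other_t.
(* The closing strands join bottom to top, where the colors agree because [t] is fixed by [w]. *)
move=> /and3P[/= /eqP-> /eqP-> /eqP->]; rewrite /color /level /=.
by rewrite take_size wt take0 /word_perm big_nil perm1.
Qed.

Lemma color_arc t s s' : word_perm Q w t = t ->
  arc_of s = arc_of s' -> color t s = color t s'.
Proof.
move=> wt /arc_of_connect; apply: connect_invariant => x y.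
by case/orP => /(color_step wt).
Qed.

Definition top_colors f : n.-tuple Q := [tuple f (point_class (ord0, p)) | p < n].

(** Induction on the level: the relations at a crossing are the hypotheses of [letter_permP], so a
    coloring propagates downwards from its top colors. *)
Lemma color_top_colors f s : quandle_morphism f ->
  f (point_class s) = color (top_colors f) s.
Proof.
move=> fM; pose T k : n.-tuple Q := [tuple f (point_class (inord k, p)) | p < n].
have TE (k : 'I_(size w).+1) p : tnth (T k) p = f (point_class (k, p)).
  by rewrite tnth_mktuple inord_val.
suff TL k : (k <= size w)%N -> T k = level (top_colors f) k.
  by case: s => k p; rewrite -TE TL // -ltnS.
elim: k => [_|k IHk k_lt].
  rewrite /level take0 /word_perm big_nil perm1; apply: eq_from_tnth => p.
  by rewrite !tnth_mktuple (_ : inord 0 = ord0) //; apply: val_inj; rewrite /= inordK.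
pose j := Ordinal k_lt; have -> : T k.+1 = T (below j) by [].
have -> : level (top_colors f) k.+1 = level (top_colors f) (below j) by [].
rewrite level_below -[level _ (above j)]/(level _ k) -(IHk (ltnW k_lt)).
rewrite -[T k]/(T (above j)).
have arc_eq s1 s2 : same_arc_step s1 s2 -> f (point_class s2) = f (point_class s1).
  by move=> /arc_of_step; rewrite /point_class => ->.
have cr : crel ((if (letter j).2 then @QOp _ else @QInv _)
    (QGen (arc_of (above j, over_top (letter j))))
    (QGen (arc_of (above j, under_top (letter j)))))
    (QGen (arc_of (below j, under_bottom (letter j)))) by exists j.
apply: letter_permP => [||p po pu]; rewrite !TE.
- apply: arc_eq; apply/orP; left; apply/existsP; exists j => /=.
  by rewrite !eqxx.
- have /qclassP := QC_rel cr; case: (letter j).2 => cE.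
    by rewrite -quandle_morphism_op // /point_class /qterm_class -cE.
  by rewrite /point_class {2}/qterm_class -cE quandle_morphism_inv.
apply: arc_eq; apply/orP; left; apply/existsP; exists j => /=.
by rewrite !eqxx (negPf po) pu.
Qed.

Lemma top_colors_fixed f : quandle_morphism f ->
  word_perm Q w (top_colors f) = top_colors f.
Proof.
move=> fM; apply: eq_from_tnth => p; rewrite [RHS]tnth_mktuple /point_class.
have <- : arc_of (w := w) (ord_max, p) = arc_of (ord0, p).
  by apply: arc_of_step; apply/orP; right; rewrite /= !eqxx.
by rewrite -/(point_class (ord_max, p)) color_top_colors // /color /level take_size.
Qed.

Lemma top_colors_inj f g : quandle_morphism f -> quandle_morphism g ->
  top_colors f = top_colors g -> f = g.
Proof.
move=> fM gM fg; apply: boolp.funext => x; rewrite -[x]qclass_repr.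
elim: (quot_repr x) => [a|a IHa b IHb|a IHa b IHb].
- have [s <-] := arc_ofP a.
  by rewrite -/(point_class s) !color_top_colors // fg.
- by rewrite [LHS](quandle_morphism_op a b fM) [RHS](quandle_morphism_op a b gM) IHa IHb.
- apply: (@qop_inj Q (f (qterm_class a))).
  rewrite [LHS](quandle_morphism_inv a b fM) [X in X ▷ _]IHa.
  by rewrite [RHS](quandle_morphism_inv a b gM).
Qed.

Fixpoint qeval (A : Type) (h : A -> Q) (x : qterm A) : Q :=
  match x with
  | QGen a => h a
  | QOp a b => qeval h a ▷ qeval h b
  | QInv a b => qdiv (qeval h a) (qeval h b)
  end.

Lemma qeval_qcong (A : Type) (rel : qterm A -> qterm A -> Prop) (h : A -> Q) x y :
  (forall x y, rel x y -> qeval h x = qeval h y) ->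
  qcong rel x y -> qeval h x = qeval h y.
Proof.
move=> relh; elim=> {x y} /=; first exact: relh.
- by [].
- by [].
- by move=> s t u _ -> _ ->.
- by move=> s s' t t' _ -> _ ->.
- by move=> s s' t t' _ -> _ ->.
- by move=> s; exact: qop_idem.
- by move=> s t; exact: qopK.
- by move=> s t; exact: qdivK.
- by move=> s t u; exact: qop_dist.
Qed.

(** The converse of [top_colors_fixed]. The last clause bounds the image of the coloring, and is
    what shows that the top colors of a dominant coloring generate [Q]. *)
Lemma coloring_exists t : word_perm Q w t = t ->
  exists f, [/\ quandle_morphism f, top_colors f = t &
    forall S : {set Q}, sqclosed S -> {subset t <= S} -> forall x, f x \in S].
Proof.
(* An arc gets the color of a chosen point on it; by [color_arc] all its points have the same
   color. *)
move=> wt; have [pt ptK] := boolp.choice arc_ofP.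
pose h a := color t (pt a).
have hE s : h (arc_of s) = color t s by apply: color_arc; rewrite ?ptK.
have h_rel x y : crel x y -> qeval h x = qeval h y.
  case=> j [-> ->] /=.
  have [_ [under_t _]] :=
    tnth_letter_perm (letter j) (level t (above j)) (over_top (letter j)).
  move: under_t; rewrite -level_below; case: (letter j).2 => /= cE.
    by rewrite !hE /color /= cE.
  by apply: (@qop_inj Q (h (arc_of (above j, over_top (letter j)))));
    rewrite qdivK !hE /color /= cE.
pose f (x : FQ) := qeval h (quot_repr x).
have fE x : f (qterm_class x) = qeval h x.
  by apply: (qeval_qcong h_rel); exact: repr_qclass.
exists f; split.
- by move=> x y; exact: fE (QOp (quot_repr x) (quot_repr y)).
- apply: eq_from_tnth => p; rewrite tnth_mktuple fE /= hE /color /level /=.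
  by rewrite take0 /word_perm big_nil perm1.
move=> S cS tS x; rewrite /f; elim: (quot_repr x) => /= [a|a IHa b IHb|a IHa b IHb].
- rewrite /h /color; have : all [in S] (level t (pt a).1).
    have /HE_of_orbit/(HE_subset cS) <- : level t (pt a).1 \in orbit 'P (hgroup Q n) t.
      by apply/orbitP; exists (word_perm Q (take (pt a).1 w)); rewrite ?word_perm_hgroup.
    exact/allP.
  by move/allP; apply; exact: mem_tnth.
- by rewrite sqclosed_qop.
- by rewrite -(sqclosed_qop _ cS IHa) qdivK.
Qed.

Lemma num_col_fix :
  num_col Q (word_closure w) = #|[set t : n.-tuple Q | word_perm Q w t == t]|.
Proof.
apply: (card_fset_set_image (f := top_colors)).
  by move=> f g /set_mem fM /set_mem gM; exact: top_colors_inj.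
apply/seteqP; split=> [_ [f fM <-]|t] /=; rewrite inE.
  by apply/eqP; exact: top_colors_fixed.
by move=> /eqP/coloring_exists[f [fM ft _]]; exists f.
Qed.

Lemma num_col_dom_fix : num_col_dom Q (word_closure w)
  = #|[set t in gen_tuples Q n | word_perm Q w t == t]|.
Proof.
apply: (card_fset_set_image (f := top_colors)).
  by move=> f g /set_mem[fM _] /set_mem[gM _]; exact: top_colors_inj.
apply/seteqP; split=> [_ [f [fM fT] <-]|t] /=; rewrite !inE.
  rewrite top_colors_fixed // eqxx andbT; apply/generatesP => S cS tS.
  have [g [gM gf gS]] := coloring_exists (top_colors_fixed fM).
  apply/setP => x; rewrite inE.
  have : (range f)%classic x by rewrite fT.
  case=> y _ <-; rewrite -(top_colors_inj gM fM gf); exact: gS.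
move=> /andP[/generatesP gt /eqP/coloring_exists[f [fM ft _]]]; exists f => //.
split=> //; apply/seteqP; split=> // x _.
(* The image of [f] is a sub-quandle containing the generating tuple [t]. *)
pose S := [set x | `[< (range f)%classic x >]].
have : x \in S.
  rewrite (gt S) ?inE //.
    apply/sqclosedP => a b; rewrite !inE => -[y _ fy] [z _ fz].
    by exists (y ▷ z); rewrite //= fM fy fz.
  move=> a; rewrite -ft => /tnthP[p ->]; rewrite inE tnth_mktuple.
  by apply/asboolP; exists (point_class (ord0, p)).
by rewrite inE => /asboolP.
Qed.

End ClosureColorings.

(** * Averages over the profinite completion *)

Section BraidRepresentation.
Variables (Q : finQuandleType) (n : nat).

Lemma braid_eq_word_perm u v : @braid_eq n u v -> word_perm Q u = word_perm Q v.
Proof.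
have wp2 (a b : 'I_n.-1 * bool) : word_perm Q [:: a; b] = letter_perm Q a * letter_perm Q b.
  by rewrite /word_perm !big_cons big_nil mulg1.
have wp3 (a b d : 'I_n.-1 * bool) : word_perm Q [:: a; b; d] =
    letter_perm Q a * letter_perm Q b * letter_perm Q d.
  by rewrite /word_perm !big_cons big_nil mulg1 mulgA.
elim=> {u v} // [u v w _ -> //|u u' v v' _ IHu _ IHv|i b|i j ij|i j ij].
- by rewrite !word_perm_cat IHu IHv.
- rewrite wp2 /letter_perm /=; case: b => /=; rewrite ?mulgV ?mulVg;
  by rewrite /word_perm big_nil.
- by rewrite !wp3; exact: hperm_braid.
- by rewrite !wp2; exact: hperm_far.
Qed.

Definition braid_perm (x : braid n) : {perm n.-tuple Q} := word_perm Q (quot_repr x).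

Lemma braid_perm_class u : braid_perm (braid_class u) = word_perm Q u.
Proof. exact/braid_eq_word_perm/repr_braid_class. Qed.

Lemma braid_permM x y : braid_perm (x * y) = braid_perm x * braid_perm y.
Proof. by rewrite [LHS]braid_perm_class word_perm_cat. Qed.

Lemma hgroup_braid_perm g : g \in hgroup Q n <-> exists x, braid_perm x = g.
Proof.
split=> [/hgroupP[w ->]|[x <-]]; last exact: word_perm_hgroup.
by exists (braid_class w); exact: braid_perm_class.
Qed.

End BraidRepresentation.

Section FiniteQuotients.
Local Open Scope classical_set_scope.
Variable G : groupType.
Implicit Types (N M : fi_normal G) (x : profinite G) (g h : G).

Section Intersection.
Variables N M : fi_normal G.

Definition inter_set : set G := ns_set N `&` ns_set M.

Lemma inter_set1 : inter_set 1.
Proof. by split; exact: ns_1. Qed.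

Lemma inter_setM g h : inter_set g -> inter_set h -> inter_set (g * h).
Proof. by move=> [Nx Mx] [Ny My]; split; exact: ns_mul. Qed.

Lemma inter_setV g : inter_set g -> inter_set g^-1.
Proof. by move=> [Nx Mx]; split; exact: ns_inv. Qed.

Lemma inter_setJ g h : inter_set g -> inter_set (g ^ h).
Proof. by move=> [Nx Mx]; split; exact: ns_conj. Qed.

Definition inter_normal := NormalSubgroup inter_set1 inter_setM inter_setV inter_setJ.

Lemma inter_finite : finite_set [set: quo inter_normal].
Proof.
pose f (q : quo inter_normal) := (quo_class N (quot_repr q), quo_class M (quot_repr q)).
rewrite -(preimage_setT f); apply: finite_preimage; last first.
  by rewrite -setXTT; apply: finite_setX; exact: fi_finite.
move=> p q _ _ [/quo_classP Npq /quo_classP Mpq].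
by rewrite -[p]quo_class_repr -[q]quo_class_repr; apply/quo_classP.
Qed.

Definition fi_inter := FiNormal inter_finite.

End Intersection.

Lemma prof_coord_inter x y N M :
  prof_coord x (fi_inter N M) = prof_coord y (fi_inter N M) ->
  prof_coord x N = prof_coord y N /\ prof_coord x M = prof_coord y M.
Proof.
move=> xy; have NI : ns_set (fi_inter N M) `<=` ns_set N by move=> ? [].
have MI : ns_set (fi_inter N M) `<=` ns_set M by move=> ? [].
by rewrite -!(prof_compat _ NI) -!(prof_compat _ MI) xy.
Qed.

(** Sets containing a coordinate fiber through [x] form a filter, since two coordinates are
    controlled by that of the intersection. It converges to [x] in each coordinate, hence in the
    product. [N0] only ensures that some coordinate exists. *)
Lemma prof_nbhs N0 x (A : set (profinite G)) : nbhs x A ->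
  exists N, forall y, prof_coord y N = prof_coord x N -> A y.
Proof.
pose F := [set B : set (profinite G) |
  exists N, forall y, prof_coord y N = prof_coord x N -> B y].
have FF : Filter F.
  split; first by exists N0.
  - move=> B C [N NB] [M MC]; exists (fi_inter N M) => y /prof_coord_inter[yN yM].
    by split; [exact: NB | exact: MC].
  - by move=> B C BC [N NB]; exists N => y /NB/BC.
suff Fx : nbhs x `<=` F by exact: Fx.
have : (fmap set_val F : set_system (quo_prod G)) --> (set_val x : quo_prod G).
  apply/cvg_sup.
  move=> N B /= [_ [[C _ <-] Cx CB]].
  by exists N => y yx; apply: CB; rewrite /= -[set_val y N]/(prof_coord y N) yx.
move=> vF B [_ [[C oC <-] Cx CB]].
have /vF : nbhs (set_val x : quo_prod G) C := open_nbhs_nbhs (conj oC Cx).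
exact: (@filterS _ F FF _ _ CB).
Qed.

(** Density of [G], with a prescribed coordinate matched exactly: [g] represents [x] modulo the
    intersection of [N0] with the subgroup that controls [A]. *)
Lemma prof_dense N0 x (A : set (profinite G)) : nbhs x A ->
  exists g, A (prof_of g) /\ quo_class N0 g = prof_coord x N0.
Proof.
move=> /(prof_nbhs N0)[N NA]; pose g := quot_repr (prof_coord x (fi_inter N0 N)).
have /prof_coord_inter[xN0 xN] :
    prof_coord (prof_of g) (fi_inter N0 N) = prof_coord x (fi_inter N0 N).
  by rewrite [LHS]quo_class_repr.
by exists g; split; first exact: NA.
Qed.

Lemma open_prof_coord N (A : set (quo N)) : open [set x | A (prof_coord x N)].
Proof.
have oA : open ([set f | A (f N)] : set (quo_prod G)).
  rewrite openE => f Af; rewrite /interior.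
  have /cvg_sup/(_ N) : nbhs (f : quo_prod G) --> (f : quo_prod G) by exact: cvg_id.
  apply; exists [set f' | A (f' N)]; split=> //.
  by exists (A : set (discrete_topology (quo N))) => //; exact: discrete_open.
by exists [set f | A (f N)].
Qed.

End FiniteQuotients.

(** * Haar integrals of functions factoring through a finite group *)

Section HaarAverage.
Import Order.TTheory GRing.Theory Num.Theory.
Local Open Scope classical_set_scope.
Local Open Scope ring_scope.
Variables (G : groupType) (gT : finGroupType) (rho : G -> gT).
Hypothesis rhoM : forall g h, rho (g * h)%g = (rho g * rho h)%g.

Let rho1 : rho 1 = 1%g.
Proof. by apply: (mulgI (rho 1)); rewrite -rhoM !mulg1. Qed.

Let rhoV g : rho g^-1%g = (rho g)^-1%g.
Proof. by apply: (mulgI (rho g)); rewrite -rhoM !mulgV rho1. Qed.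

Let ker_set : set G := [set g | rho g = 1%g].

Let ker_set1 : ker_set 1%g. Proof. exact: rho1. Qed.

Let ker_setM g h : ker_set g -> ker_set h -> ker_set (g * h)%g.
Proof. by rewrite /ker_set /= rhoM => -> ->; rewrite mulg1. Qed.

Let ker_setV g : ker_set g -> ker_set g^-1%g.
Proof. by rewrite /ker_set /= rhoV => ->; rewrite invg1. Qed.

Let ker_setJ g h : ker_set g -> ker_set (g ^ h)%g.
Proof. by rewrite /ker_set /= conjgE !rhoM rhoV => ->; rewrite mul1g mulVg. Qed.

Definition ker_normal := NormalSubgroup ker_set1 ker_setM ker_setV ker_setJ.

Lemma rho_quo_class g h :
  quo_class ker_normal g = quo_class ker_normal h <-> rho g = rho h.
Proof.
split=> [/quo_classP|gh]; last apply/quo_classP; rewrite /= /ker_set /= rhoM rhoV.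
  by move/(congr1 (mulg (rho g))); rewrite mulKVg mulg1.
by rewrite gh mulVg.
Qed.

Lemma ker_finite : finite_set [set: quo ker_normal].
Proof.
pose f (q : quo ker_normal) := rho (quot_repr q).
rewrite -(preimage_setT f); apply: finite_preimage; last exact: finite_finset.
move=> p q _ _ /rho_quo_class; by rewrite !quo_class_repr.
Qed.

Definition ker_fi : fi_normal G := FiNormal ker_finite.

(** The continuous extension of [rho] to the profinite completion, read off the coordinate at its
    kernel. *)
Definition prof_rho (x : profinite G) : gT := rho (quot_repr (prof_coord x ker_fi)).

Lemma prof_rhoE x g : quo_class ker_fi g = prof_coord x ker_fi -> prof_rho x = rho g.
Proof. by move=> gx; apply/rho_quo_class; rewrite quo_class_repr gx. Qed.

Lemma prof_rho_mul g x : prof_rho (prof_of g * x)%g = (rho g * prof_rho x)%g.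
Proof.
rewrite -rhoM; apply: prof_rhoE.
by rewrite -[LHS]quo_classM quo_class_repr.
Qed.

(** [c] is constant near [x], and by density some [g] near [x] has the same image in the finite
    group. *)
Lemma continuous_extension_factor (F : gT -> nat) (c : profinite G -> nat) x :
  continuous_extension (fun g => F (rho g)) c -> c x = F (prof_rho x).
Proof.
move=> [c_cont cE].
have : nbhs x [set y | c y = c x].
  exact: (c_cont x _ (discrete_set1 (c x))).
move=> /(prof_dense ker_fi)[g [/= cg gx]].
by rewrite -cg cE (prof_rhoE gx).
Qed.

Variables (R : realType) (mu : probability (borel_profinite G) R).
Hypothesis mu_haar : is_haar mu.

Let fiber (a : gT) : set (borel_profinite G) := [set x | prof_rho x = a].

Let measurable_fiber a : measurable (fiber a).
Proof.
apply: sub_sigma_algebra.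
exact: (@open_prof_coord G ker_fi (fun q => rho (quot_repr q) = a)).
Qed.

Let mu_fiber g : mu (fiber (rho g)) = mu (fiber 1%g).
Proof.
rewrite -(mu_haar (prof_of g) (measurable_fiber 1%g)); congr (mu _).
apply/seteqP; split=> [x|_ [x x1 <-]]; rewrite /fiber /=; last first.
  by rewrite prof_rho_mul x1 mulg1.
move=> xg; exists (prof_of g^-1 * x)%g; first by rewrite prof_rho_mul xg rhoV mulVg.
rewrite mulgA -[RHS]mul1g; congr (_ * _)%g; apply: prof_ext => N.
by rewrite [LHS]quo_classM mulgV.
Qed.

(* The fibers of [prof_rho] over the image of [rho] are translates of each other. *)
Lemma haar_average (H : {group gT}) (F : gT -> nat) (c : profinite G -> nat) :
    (forall a, a \in H <-> exists g, rho g = a) ->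
    continuous_extension (fun g => F (rho g)) c ->
  (\int[mu]_x ((c x)%:R)%:E = ((\sum_(a in H) F a)%:R / #|H|%:R)%:E)%E.
Proof.
move=> HP cF.
(* The integrand is a combination of indicators of fibers, all of the same measure. The constant [K]
   equal to 1 then gives that measure as 1/|H|. *)
have avg (K : gT -> nat) : (\int[mu]_x ((K (prof_rho x))%:R)%:E =
    (\sum_(a in H) K a)%:R%:E * mu (fiber 1%g))%E.
  transitivity (\int[mu]_x (\sum_(a <- enum H) ((K a)%:R%:E * (\1_(fiber a) x)%:E)))%E.
    apply: eq_integral => x _.
    have xH : prof_rho x \in H by apply/HP; eexists.
    rewrite big_enum (bigD1 (prof_rho x)) //= indicE mem_set // mule1 big1 ?adde0 //.
    move=> a /andP[_ ax]; rewrite indicE memNset ?mule0 // /fiber /=.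
    by move=> xa; rewrite xa eqxx in ax.
  rewrite ge0_integral_sum ?big_enum //; last first.
  - move=> a; apply: measurable_funeM; apply/measurable_realfun.measurable_EFinP.
    exact: measurable_realfun.measurable_indic.
  rewrite natr_sum -sumEFin ge0_sume_distrl; last by [].
  apply: eq_bigr => a /HP[g <-].
  rewrite ge0_integralZl ?lee_fin //; last first.
    by apply/measurable_realfun.measurable_EFinP; exact: measurable_realfun.measurable_indic.
  rewrite integral_indic // setIT; congr (_ * _)%E; exact: mu_fiber.
have fin1 : mu (fiber 1%g) \is a fin_num by exact: fin_num_measure.
have mass : mu (fiber 1%g) = (#|H|%:R^-1)%:E.
  have := avg (fun=> 1%N); rewrite sum1_card integral_cst //= mul1e.
  rewrite probability_setT -(fineK fin1) -EFinM => -[] e.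
  congr (_%:E); apply: (@mulfI _ #|H|%:R); first by rewrite pnatr_eq0 -lt0n cardG_gt0.
  by rewrite -e mulfV // pnatr_eq0 -lt0n cardG_gt0.
rewrite EFinM -mass -avg; apply: eq_integral => x _.
by rewrite (continuous_extension_factor x cF).
Qed.

End HaarAverage.

(** * Growth of polynomials *)

Section PolynomialGrowth.
Import Order.TTheory GRing.Theory Num.Theory.
Local Open Scope ring_scope.
Implicit Types (p : {poly rat}) (n k C a d : nat).

Lemma horner_nat_gt0 p : 0 < lead_coef p ->
  exists n0, forall n, (n0 <= n)%N -> 0 < p.[n%:R].
Proof.
move=> lp; have [x px] := polyrcf.poly_pinfty_gt_lc lp.
exists (Num.Def.archi_bound `|x|) => n xn; apply: lt_le_trans lp (px _ _).
apply: le_trans (ler_norm x) (le_trans (ltW (archi_boundP (normr_ge0 x))) _).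
by rewrite ler_nat.
Qed.

Let XD1E : 'X + 1 = 'X - (-1)%:P :> {poly rat}.
Proof. by rewrite polyCN opprK. Qed.

Let size_XD1_exp k : size (('X + 1 : {poly rat}) ^+ k) = k.+1.
Proof. by rewrite XD1E size_exp_XsubC. Qed.

Let monic_XD1 : 'X + 1 \is @monic rat.
Proof. by rewrite XD1E monicXsubC. Qed.

Let horner_XD1 n : ('X + 1 : {poly rat}).[n%:R] = n.+1%:R.
Proof. by rewrite !hornerE natr1. Qed.

Let size_mul_XD1 p : p != 0 -> size (p * ('X + 1)) = (size p).+1.
Proof.
by move=> p0; rewrite size_Mmonic ?monic_XD1 // -['X + 1]expr1 size_XD1_exp addn2.
Qed.

(** If the size of [p] exceeded [k], then p(X+1) would dominate C(X+1)^k, and their difference [q]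
    would be positive at large integers. *)
Lemma size_poly_le_of_upper p C k :
    (exists n0, forall n, (n0 <= n)%N ->
       0 <= p.[n%:R] /\ p.[n%:R] * n.+1%:R <= C%:R * n.+1%:R ^+ k) ->
  (size p <= k)%N.
Proof.
move=> [n0 pP]; rewrite leqNgt; apply/negP => kp.
have p0 : p != 0 by rewrite -size_poly_gt0 (leq_trans _ kp).
(* Otherwise [p] would be negative at large integers. *)
have lp : 0 < lead_coef p.
  rewrite lt_neqAle eq_sym lead_coef_eq0 p0 leNgt; apply/negP.
  rewrite -oppr_gt0 -lead_coefN => /horner_nat_gt0[n1 n1P].
  have := n1P _ (leq_maxr n0 n1); rewrite hornerN oppr_gt0 ltNge.
  by have [-> _] := pP _ (leq_maxl n0 n1).
pose q := p * ('X + 1) - C%:R *: ('X + 1) ^+ k.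
have : lead_coef q = lead_coef p.
  rewrite lead_coefDl ?lead_coef_Mmonic //.
  rewrite size_polyN size_mul_XD1 // ltnS; apply: leq_trans kp.
  by apply: leq_trans (size_scale_leq _ _) _; rewrite size_XD1_exp.
move=> lq; have [|n1 n1P] := @horner_nat_gt0 q; first by rewrite lq.
have := n1P _ (leq_maxr n0 n1); rewrite !hornerE !natr1.
rewrite subr_gt0 ltNge.
by have [_ ->] := pP _ (leq_maxl n0 n1).
Qed.

(** The comparison is made along the progression a + dj: the substitution does not increase the
    size, so for small [p] the term (X+1)^k would dominate. *)
Lemma size_poly_ge_of_lower p a d k :
    (exists j0, forall j, (j0 <= j)%N ->
       j.+1%:R ^+ k <= p.[(a + d * j)%:R] * j.+1%:R) ->
  (k <= size p)%N.
Proof.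
move=> [j0 pP]; rewrite leqNgt; apply/negP => pk.
pose r : {poly rat} := p \Po (d%:R *: 'X + a%:R%:P).
have rE n : r.[n%:R] = p.[(a + d * n)%:R].
  by rewrite horner_comp !hornerE addrC natrD natrM.
have size_r : (size r <= size p)%N.
  rewrite /r; have [->|p0] := eqVneq p 0; first by rewrite comp_poly0.
  apply: leq_trans (size_comp_poly_leq _ _) _.
  have lin_le : ((size (d%:R *: 'X + a%:R%:P : {poly rat})%R).-1 <= 1)%N.
    rewrite -subn1 leq_subLR; apply: leq_trans (size_polyD _ _) _.
    rewrite geq_max (leq_trans (size_scale_leq _ _)) ?size_polyX //.
    exact: leq_trans (size_polyC_leq1 _) _.
  rewrite -[leqRHS]prednK ?size_poly_gt0 // ltnS.
  by apply: leq_trans (leq_mul (leqnn _) lin_le) _; rewrite muln1.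
pose q := ('X + 1) ^+ k - r * ('X + 1).
have : lead_coef q = 1.
  rewrite lead_coefDl; first by apply/eqP; rewrite -monicE monic_exp.
  rewrite size_polyN size_XD1_exp; have [->|r0] := eqVneq r 0.
    by rewrite mul0r size_poly0.
  by rewrite size_mul_XD1 // ltnS (leq_ltn_trans size_r).
move=> lq; have [|n1 n1P] := @horner_nat_gt0 q; first by rewrite lq.
have := n1P _ (leq_maxr j0 n1); rewrite hornerD hornerN hornerM horner_exp !horner_XD1.
by rewrite rE subr_gt0 ltNge pP ?leq_maxl.
Qed.

End PolynomialGrowth.

(** * Integrals as orbit counts, and the degrees *)

Section Main.
Import Order.TTheory GRing.Theory Num.Theory.
Local Open Scope ring_scope.

(** Growth of order n^(k-1) means size [k]. The extra factor on the side of [N] stands for the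
    exponent k-1, so that k = 0, where [p] vanishes, is covered as well. *)
Lemma size_counting_poly (p : {poly rat}) (N : nat -> nat) k :
    (exists n0, forall n, (n0 <= n)%N -> p.[n%:R] = (N n)%:R) ->
    (exists C, forall n, (0 < n)%N -> (N n * n.+1 <= C * n.+1 ^ k)%N) ->
    ((0 < k)%N -> exists a, forall j,
       (j.+1 ^ k <= N (a + k * j) * j.+1)%N) ->
  size p = k.
Proof.
move=> [n0 pN] [C NC] NL; apply/eqP; rewrite eqn_leq; apply/andP; split.
  apply: (@size_poly_le_of_upper _ C); exists (maxn n0 1) => n.
  rewrite geq_max => /andP[n0n n1]; rewrite pN // ler0n; split=> //.
  by rewrite -natrX -!natrM ler_nat NC.
have [->//|k_gt0] := posnP k; have [a NLa] := NL k_gt0.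
apply: (@size_poly_ge_of_lower _ a k); exists n0 => j n0j.
rewrite pN; first by rewrite -natrX -natrM ler_nat.
by apply: leq_trans n0j (leq_trans _ (leq_addl _ _)); rewrite leq_pmull.
Qed.

Section Orbits.
Variables (R : realType) (Q : finQuandleType) (n : nat).
Variables (mu : probability (borel_profinite (braid n)) R) (mu_haar : is_haar mu).

(* The average number of fixed points of a finite group is its number of orbits
   (Burnside). *)
Lemma haar_fixed_points (S : {set n.-tuple Q}) (f : braid n -> nat)
    (c : profinite (braid n) -> nat) :
    [acts hgroup Q n, on S | 'P] ->
    (forall s, f s = #|[set t in S | braid_perm Q s t == t]|) ->
    continuous_extension f c ->
  (\int[mu]_x ((c x)%:R)%:E = (#|[set orbit 'P (hgroup Q n) t | t in S]|%:R)%:E)%E.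
Proof.
move=> actS fE [c_cont cf].
pose F (a : {perm n.-tuple Q}) := #|'Fix_(S | 'P)[a]%g|.
have cF : continuous_extension (fun s => F (braid_perm Q s)) c.
  split=> // s; rewrite cf fE; apply: eq_card => t; rewrite inE finset.in_setI.
  by congr (_ && _); apply/eqP/afix1P.
rewrite (haar_average (@braid_permM Q n) mu_haar (hgroup_braid_perm (n := n)) cF).
congr (_%:E); rewrite Frobenius_Cauchy // natrM mulfK //.
by rewrite pnatr_eq0 -lt0n cardG_gt0.
Qed.

Lemma integral_num_col c :
    continuous_extension (fun s : braid n => num_col Q (braid_closure s)) c ->
  (\int[mu]_x ((c x)%:R)%:E = (#|all_orbits Q n|%:R)%:E)%E.
Proof.
apply: haar_fixed_points => [|s]; first by apply/actsP => a _ t; rewrite !inE.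
by rewrite num_col_fix; apply: eq_card => t; rewrite !inE.
Qed.

Lemma integral_num_col_dom c :
    continuous_extension (fun s : braid n => num_col_dom Q (braid_closure s)) c ->
  (\int[mu]_x ((c x)%:R)%:E = (#|gen_orbits Q n|%:R)%:E)%E.
Proof.
apply: haar_fixed_points => [|s]; last by rewrite num_col_dom_fix.
by apply/actsP => a aH t; apply: gen_tuples_orbit; exact: mem_orbit.
Qed.

End Orbits.
End Main.

Local Open Scope classical_set_scope.
Local Open Scope ring_scope.

Theorem theorem2p28 (R : realType) (Q : finQuandleType)
  (mu : forall n : nat, probability (borel_profinite (braid n)) R)
  (mu_haar : forall n : nat, is_haar (mu n))
  (c cdom : forall n : nat, profinite (braid n) -> nat)
  (c_ext : forall n : nat,
     continuous_extension (fun s : braid n => num_col Q (braid_closure s)) (c n))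
  (cdom_ext : forall n : nat,
     continuous_extension (fun s : braid n => num_col_dom Q (braid_closure s))
       (cdom n))
  (P Pdom : {poly rat})
  (P_int : exists n0 : nat, forall n : nat, (n0 <= n)%N ->
     (\int[mu n]_x ((c n x)%:R)%:E = (ratr P.[n%:R])%:E)%E)
  (Pdom_int : exists n0 : nat, forall n : nat, (n0 <= n)%N ->
     (\int[mu n]_x ((cdom n x)%:R)%:E = (ratr Pdom.[n%:R])%:E)%E) :
  degree Pdom = #|pi0 Q|%:Z - 1 /\ degree P = (quandle_dim Q)%:Z - 1.
Proof.
(* The integrals are real and the polynomials rational; the embedding of the rationals is
   injective. *)
have ratr_nat_inj (q : rat) (m : nat) :
    (m%:R)%:E = (ratr q : R)%:E -> q = m%:R.
  by move=> [] /esym; rewrite -(ratr_nat R m) => /GRing.fmorph_inj.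
have [n0 P_orb] := P_int; have [n1 Pdom_orb] := Pdom_int.
rewrite /degree (@size_counting_poly Pdom (fun n => #|gen_orbits Q n|) #|pi0 Q|).
- rewrite (@size_counting_poly P (fun n => #|all_orbits Q n|) (quandle_dim Q)) //.
  + by exists n0 => n /P_orb; rewrite (integral_num_col (mu_haar n) (c_ext n)) => /ratr_nat_inj.
  + exact: all_orbits_upper.
  + exact: all_orbits_lower.
- by exists n1 => n /Pdom_orb; rewrite (integral_num_col_dom (mu_haar n) (cdom_ext n)) => /ratr_nat_inj.
- exact: gen_orbits_upper.
- by move=> k_gt0; exists #|Q| => j; exact: gen_orbits_lower.
Qed.
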